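(* As $a \to \infty$ through the positive integers, $$R(6,a) = \tfrac{185521}{86400}a^5 - \tfrac{266581}{6912}a^4 + \tfrac{4268287}{12960}a^3 + O(a^2).$$
   Context: A finite lattice is graded of rank $3$ if every maximal chain (from bottom to top) has exactly four elements; its elements then lie on four levels: the bottom, the atoms (elements covering the bottom), the coatoms (elements covered by the top), and the top. For integers $c, a \ge 1$, $R(c,a)$ denotes the number of unlabeled graded lattices of rank $3$ (that is, the number of isomorphism classes of such lattices) with exactly $c$ coatoms and exactly $a$ atoms. *)

(* Defs.v *)
From HB Require Import structures.
From mathcomp Require Import all_boot all_order all_algebra.
From mathcomp Require Import all_classical all_reals all_analysis.

Set Implicit Arguments.
Unset Strict Implicit.
Unset Printing Implicit Defensive.

Import Order.TTheory.
Local Open Scope order_scope.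

Section FiniteLattices.
Context {d : Order.disp_t} (L : finTBLatticeType d).

Definition covers (x y : L) : bool :=
  (x < y) && ~~ [exists z : L, (x < z) && (z < y)].

Definition atoms : {set L} := [set x | covers \bot x].

Definition coatoms : {set L} := [set x | covers x \top].

Definition chain (C : {set L}) : bool :=
  [forall x in C, forall y in C, x >=< y].

Definition graded_rank3 : Prop :=
  forall C : {set L}, maxset chain C -> #|C| = 4.

Definition rank3_lattice (c a : nat) : Prop :=
  [/\ graded_rank3, #|coatoms| = c & #|atoms| = a].

End FiniteLattices.

(* An order isomorphism between lattices is a lattice isomorphism. *)
Definition isomorphic {d d' : Order.disp_t}
    (L : finTBLatticeType d) (M : finTBLatticeType d') : Prop :=
  exists2 f : L -> M, bijective f & {mono f : x y / x <= y}.

(* There are exactly N isomorphism classes of rank 3 lattices with c coatoms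
   and a atoms: some N such lattices form a system of representatives. *)
Definition num_iso_classes (c a N : nat) : Prop :=
  exists (d : 'I_N -> Order.disp_t) (L : forall i, finTBLatticeType (d i)),
  [/\ forall i, rank3_lattice (L i) c a,
      forall i j, isomorphic (L i) (L j) -> i = j &
      forall (d' : Order.disp_t) (M : finTBLatticeType d'),
        rank3_lattice M c a -> exists i, isomorphic M (L i)].

(* The default value 0 of xget is never used: see num_iso_classes_R and
   num_iso_classes_unique. *)
Definition R (c a : nat) : nat := xget 0%N (num_iso_classes c a).

Lemma isomorphic_sym d d' (L : finTBLatticeType d) (M : finTBLatticeType d') :
  isomorphic L M -> isomorphic M L.
Proof.
case=> f [g fK gK] fm; exists g; first by exists f.
by move=> x y; rewrite -{2}(gK x) -{2}(gK y) fm.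
Qed.

Lemma isomorphic_trans d1 d2 d3 (L1 : finTBLatticeType d1)
    (L2 : finTBLatticeType d2) (L3 : finTBLatticeType d3) :
  isomorphic L1 L2 -> isomorphic L2 L3 -> isomorphic L1 L3.
Proof.
case=> f bf fm [g bg gm]; exists (g \o f); first exact: bij_comp.
by move=> x y /=; rewrite gm fm.
Qed.

Lemma num_iso_classes_leq c a N N' :
  num_iso_classes c a N -> num_iso_classes c a N' -> (N <= N')%N.
Proof.
move=> [d [L [PL injL _]]] [d' [L' [_ _ surL']]].
have /choice[h hP] i : exists j, isomorphic (L i) (L' j) by exact: surL'.
rewrite -(card_ord N) -(card_ord N'); apply: (leq_card h) => i j hij.
apply: injL; apply: isomorphic_trans (hP i) _.
by rewrite hij; apply/isomorphic_sym/hP.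
Qed.

Lemma num_iso_classes_unique c a N N' :
  num_iso_classes c a N -> num_iso_classes c a N' -> N = N'.
Proof. by move=> H H'; apply/eqP; rewrite eqn_leq !(@num_iso_classes_leq c a). Qed.

Lemma rank3_lattice_card d (L : finTBLatticeType d) c a :
  rank3_lattice L c a -> (#|L| <= 2 + (c + a))%N.
Proof.
case=> gL <- <-.
have -> : #|L| = #|[set: L]| by rewrite cardsT.
suff sub : [set: L] \subset [set \bot; \top] :|: (coatoms L :|: atoms L).
  apply: leq_trans (subset_leq_card sub) _.
  rewrite cardsU; apply: leq_trans (leq_subr _ _) _.
  apply: leq_add; first by rewrite cards2 ltnS leq_b1.
  by rewrite cardsU leq_subr.
apply/fintype.subsetP => x _; rewrite !inE /covers; apply: contraT.
rewrite !negb_or !negb_and !negbK lt0x ltx1 => /andP[/andP[xb xt]].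
rewrite xb xt /= => /andP[/existsP[z /andP[xz zt]] /existsP[y /andP[by_ yx]]].
pose s := [:: \bot; y; x; z; \top : L].
have ss : sorted <%O s by rewrite /= by_ yx xz zt.
have us : uniq s by exact: lt_sorted_uniq ss.
have cs : chain [set u in s].
  have ls : pairwise <=%O s.
    by rewrite -(sorted_pairwise le_trans) /= !ltW.
  apply/'forall_implyP => u; rewrite inE => us'.
  apply/'forall_implyP => v; rewrite inE => vs.
  move: us' vs; rewrite !inE.
  move: ls => /= /and5P[/and5P[? ? ? ? _] /and4P[? ? ? _] /and3P[? ? _] /andP[? _] _].
  by do 4?[case/predU1P => [->|]]; [..|move=> /eqP ->];
    do 4?[case/predU1P => [->|]]; try (move=> /eqP ->);
    rewrite ?comparablexx // /Order.comparable; apply/orP; auto.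
have [C maxC sC] := maxset_exists cs.
have := subset_leq_card sC; rewrite (gL _ maxC).
by rewrite cardsE (card_uniqP us).
Qed.

Section Code.
Variable K : nat.
Let T := ('I_K.+1 * {set 'I_K * 'I_K})%type.

Let code d (L : finTBLatticeType d) : T :=
  (inord #|L|,
   [set p : 'I_K * 'I_K | [exists x : L, exists y : L,
     [&& enum_rank x == p.1 :> nat, enum_rank y == p.2 :> nat & x <= y]]]).

Lemma code_isomorphic d d' (L : finTBLatticeType d) (M : finTBLatticeType d') :
  (#|L| <= K)%N -> (#|M| <= K)%N -> code L = code M -> isomorphic L M.
Proof.
move=> LK MK [/(congr1 (@nat_of_ord _)) + eLM].
rewrite !inordK ?ltnS// => e.
pose f (x : L) : M := enum_val (cast_ord e (enum_rank x)).
pose g (x : M) : L := enum_val (cast_ord (esym e) (enum_rank x)).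
exists f; first by exists g => x; rewrite /f /g enum_valK ?cast_ordK ?cast_ordKV enum_rankK.
have codeP d0 (L0 : finTBLatticeType d0) (L0K : (#|L0| <= K)%N) (x y : L0) :
    ((widen_ord L0K (enum_rank x), widen_ord L0K (enum_rank y)) \in (code L0).2)
    = (x <= y).
  rewrite inE; apply/existsP/idP => [[u /existsP[v /and3P[]]]|xy].
    by move=> /eqP/ord_inj/enum_rank_inj -> /eqP/ord_inj/enum_rank_inj ->.
  by exists x; apply/existsP; exists y; rewrite /= !eqxx.
move=> x y; rewrite -(codeP _ L LK) -(codeP _ M MK) /= -eLM.
have fE z : widen_ord MK (enum_rank (f z)) = widen_ord LK (enum_rank z).
  by apply: val_inj; rewrite /= /f enum_valK.
by rewrite !fE.
Qed.

Lemma num_iso_classes_bounded c a :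
  (forall d (L : finTBLatticeType d), rank3_lattice L c a -> (#|L| <= K)%N) ->
  exists N, num_iso_classes c a N.
Proof.
move=> bnd.
pose real (t : T) (d : Order.disp_t) (L : finTBLatticeType d) :=
  rank3_lattice L c a /\ code L = t.
pose iso_to d (L : finTBLatticeType d) (t : T) :=
  exists d' (M : finTBLatticeType d'), real t d' M /\ isomorphic L M.
pose reps : {set T} := [set t | `[< exists d (L : finTBLatticeType d),
  real t d L /\ forall t', iso_to d L t' -> (enum_rank t <= enum_rank t')%N >]].
exists #|reps|.
have /choice[F FP] (i : 'I_#|reps|) :
    exists s : {d & finTBLatticeType d}, real (enum_val i) (tag s) (tagged s) /\
      forall t', iso_to _ (tagged s) t' -> (enum_rank (enum_val i) <= enum_rank t')%N.
  have := enum_valP i; rewrite inE => /asboolP[d [L HL]].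
  by exists (Tagged (fun d => finTBLatticeType d) L).
exists (fun i => tag (F i)), (fun i => tagged (F i)); split.
- by move=> i; case: (FP i) => -[].
- move=> i j Lij; apply: enum_val_inj; apply: enum_rank_inj; apply: val_inj.
  apply/eqP; rewrite eqn_leq; have [ri mi] := FP i; have [rj mj] := FP j.
  apply/andP; split.
    by apply: mi; exists (tag (F j)), (tagged (F j)).
  by apply: mj; exists (tag (F i)), (tagged (F i)); split=> //; exact: isomorphic_sym.
- move=> d M PM.
  have M0 : `[< iso_to d M (code M) >].
    by apply/asboolP; exists d, M; split; [split|exists id => //; exists id].
  case: (arg_minnP (P := fun t => `[< iso_to d M t >])
    (fun t : T => nat_of_ord (enum_rank t)) M0) => t /asboolP.
  move=> [d1 [M1 [r1 MM1]]] tmin.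
  have tr : t \in reps.
    rewrite inE; apply/asboolP; exists d1, M1; split=> // t' [d2 [M2 [r2 M12]]].
    apply: tmin; apply/asboolP; exists d2, M2; split=> //.
    exact: isomorphic_trans MM1 M12.
  exists (enum_rank_in tr t); apply: isomorphic_trans MM1 _.
  have [[P1 c1] _] := FP (enum_rank_in tr t).
  apply: code_isomorphic; [exact: bnd r1.1|exact: bnd P1|].
  by rewrite r1.2 c1 enum_rankK_in.
Qed.

End Code.

Lemma num_iso_classes_R c a : num_iso_classes c a (R c a).
Proof.
have [N HN] := num_iso_classes_bounded
  (fun d (L : finTBLatticeType d) => @rank3_lattice_card d L c a).
by apply: xgetPex; exists N.
Qed.

(* Main.v *)
(* A rank 3 lattice with 6 coatoms is determined by the sets of coatoms above its
   atoms: nonempty subsets of a 6-element set, any two of which meet in at most one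
   point.  The sets with at least two elements form a partial linear space H, and
   the rest is a multiplicity for each singleton, which has to be positive at the
   points not covered by H.  Subtracting this forced 1 leaves arbitrary naturals
   m with |H| + #uncovered + sum m = a, and the lattices are the orbits of S_6 on
   such pairs (H, m).

   By Burnside, 720 R(6, a) is the sum over the permutations g of the number of
   fixed pairs.  For a fixed g-invariant H, the number of g-invariant m is a
   denumerant of the cycle lengths of g, of order a^(cycles - 1); so only the
   identity, the 15 transpositions, the 40 three-cycles and the 45 double
   transpositions contribute beyond O(a^2).  For these the expansion depends only
   on the first moments of w(H) = |H| + #uncovered over the g-invariant H, which
   are obtained by an exhaustive clique enumeration over the g-orbits of blocks. *)
From mathcomp Require Import all_fingroup.
Require Import Defs.
From HB Require Import structures.
From mathcomp Require Import all_boot all_order all_algebra.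
From mathcomp Require Import all_classical all_reals all_analysis.
From mathcomp Require Import ring lra zify.
From Stdlib Require BinNat Nnat Pnat.
Import Order.TTheory GRing.Theory Num.Theory.
Import numFieldNormedType.Exports.
Local Open Scope classical_set_scope.
Local Open Scope ring_scope.

Set Implicit Arguments.
Unset Strict Implicit.
Unset Printing Implicit Defensive.

(** * The lattice of an incidence relation *)

Section IncidenceLattice.
Import mathcomp.boot.fintype mathcomp.boot.finset.
Local Open Scope nat_scope.
Local Open Scope set_scope.

(** The enumeration over the spaces H has to be run by [vm_compute], and this shapes the middle of
    the proof. Blocks are bit sequences, permutations are lists and sums are binary numbers; the
    orbit lists and the cycle data are certified by boolean tests that are evaluated, so their
    generators need no correctness proof of their own. Replacing [a] by [a - w] in
    [c5 a^5 + c4 a^4 + c3 a^3] brings [w] into the coefficient of [a^4], and [w] and [w^2] into that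
    of [a^3]; so the moments of order 0, 1 and 2 are what has to be computed. The leading
    coefficient is 185521 / (720 * 120): there are 185521 spaces H on six labelled points, and 1/120
    is the leading coefficient of the binomial of [s + 5] over 5, which counts the multiplicities
    for the identity. Transpositions, with five cycles, enter from [a^4] on; three-cycles and double
    transpositions, with four, only at [a^3]. *)

Definition linear_inc (A C : finType) (r : A -> {set C}) : Prop :=
  forall x y, x != y -> #|r x :&: r y| <= 1.

(* The proof of linearity is a parameter of the type so that the lattice
   instance, which depends on it, can be inferred. *)
Definition inc_lat (A C : finType) (r : A -> {set C}) (rlin : linear_inc r)
  : Type := (bool + (A + C))%type.

Variables (A C : finType) (r : A -> {set C}) (rlin : linear_inc r).
Local Notation L := (inc_lat rlin).

HB.instance Definition _ := Finite.copy L (bool + (A + C))%type.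

Definition bot_inc : L := inl false.
Definition top_inc : L := inl true.
Definition atom_inc (a : A) : L := inr (inl a).
Definition coatom_inc (c : C) : L := inr (inr c).

Definition le_inc (x y : L) : bool :=
  match x, y with
  | inl false, _ | _, inl true => true
  | inr (inl a), inr (inl b) => a == b
  | inr (inl a), inr (inr c) => c \in r a
  | inr (inr c), inr (inr c') => c == c'
  | _, _ => false
  end.

Definition meet_inc (x y : L) : L :=
  match x, y with
  | inl false, _ | _, inl false => bot_inc
  | inl true, z | z, inl true => z
  | inr (inl a), inr (inl b) => if a == b then x else bot_inc
  | inr (inl a), inr (inr c) | inr (inr c), inr (inl a) =>
    if c \in r a then atom_inc a else bot_inc
  | inr (inr c), inr (inr c') => if c == c' then x else
    if [pick a | (c \in r a) && (c' \in r a)] is Some a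
    then atom_inc a else bot_inc
  end.

Definition join_inc (x y : L) : L :=
  match x, y with
  | inl true, _ | _, inl true => top_inc
  | inl false, z | z, inl false => z
  | inr (inr c), inr (inr c') => if c == c' then x else top_inc
  | inr (inl a), inr (inr c) | inr (inr c), inr (inl a) =>
    if c \in r a then coatom_inc c else top_inc
  | inr (inl a), inr (inl b) => if a == b then x else
    if [pick c | (c \in r a) && (c \in r b)] is Some c
    then coatom_inc c else top_inc
  end.

Lemma le_inc_refl : reflexive le_inc.
Proof. by case=> [[]|[]]/=. Qed.

Lemma le_inc_anti : antisymmetric le_inc.
Proof.
by case=> [[]|[a|c]] [[]|[b|c']] //=; rewrite ?andbF //; case/andP => /eqP ->.
Qed.

Lemma le_inc_trans : transitive le_inc.
Proof.
by case=> [[]|[a|c]] [[]|[b|c']] [[]|[e|c'']] //=;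
  do ?[move/eqP->]; do ? [move=> + /eqP<-].
Qed.

(** Linearity is self-dual: two distinct coatoms share at most one atom. So the element found by
    [pick] in [meet_inc] or [join_inc] is the only candidate. *)
Lemma inc_uniq a b c c' :
  c != c' -> c \in r a -> c' \in r a -> c \in r b -> c' \in r b -> a = b.
Proof.
move=> cc' ca c'a cb c'b; apply/eqP; apply: contraT => /rlin.
by rewrite leqNgt (cardD1 c) (cardD1 c') !inE ca c'a cb c'b eq_sym cc'.
Qed.

HB.instance Definition _ := Order.Le_isPOrder.Build (Order.Disp tt tt) L
  le_inc_refl le_inc_anti le_inc_trans.


Local Open Scope order_scope.

Lemma le_incE (x y : L) : (x <= y) = le_inc x y. Proof. by []. Qed.

Lemma le0_inc (x : L) : bot_inc <= x. Proof. by []. Qed.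
Lemma le1_inc (x : L) : x <= top_inc. Proof. by case: x => [[]|[]]. Qed.

HB.instance Definition _ := Order.hasBottom.Build (Order.Disp tt tt) L le0_inc.
HB.instance Definition _ := Order.hasTop.Build (Order.Disp tt tt) L le1_inc.

Lemma meet_incP (x y z : L) : (x <= meet_inc y z) = (x <= y) && (x <= z).
Proof.
rewrite !le_incE.
case: y z => [[]|[b|c]] [[]|[b'|c']] /=; case: x => [[]|[a|e]] //=;
  rewrite ?andbT ?andbF //; try by case: ifP.
- have [->|bb'] := eqVneq b b'; first by rewrite andbb.
  by rewrite /=; case: eqVneq => // ->; rewrite (negPf bb').
- case: ifP => /= c'b; first by case: eqVneq => // ->; rewrite c'b.
  by case: eqVneq => // ->; rewrite c'b.
- case: ifP => /= cb'; first by case: eqVneq => [->|]; rewrite ?cb' ?andbF.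
  by case: eqVneq => [->|]; rewrite ?cb' ?andbF.
- by case: eqP => // _; case: pickP.
- case: eqVneq => [->|cc'] /=; first by rewrite andbb.
  case: pickP => [a' /andP[ca' c'a']|na] /=; last by rewrite na.
  case: eqVneq => [->|aa']; first by rewrite ca' c'a'.
  apply/esym/negbTE; apply: contraNN aa' => /andP[ca c'a].
  by rewrite (inc_uniq cc' ca c'a ca' c'a').
- case: eqVneq => [->|cc'] /=; first by rewrite andbb.
  have -> : (e == c) && (e == c') = false.
    by case: eqVneq => // ->; rewrite (negPf cc').
  by case: pickP.
Qed.

Lemma join_incP (x y z : L) : (join_inc x y <= z) = (x <= z) && (y <= z).
Proof.
rewrite !le_incE.
case: x y => [[]|[b|c]] [[]|[b'|c']] /=; case: z => [[]|[a|e]] //=;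
  rewrite ?andbT ?andbF //; try by case: ifP.
- by case: eqP => // _; case: pickP.
- by case: eqP => // _; case: pickP.
- case: eqVneq => [->|bb'] /=; first by rewrite andbb.
  have -> : (b == a) && (b' == a) = false.
    by apply: contra_neqF bb' => /andP[/eqP-> /eqP->].
  by case: pickP.
- case: eqVneq => [->|bb'] /=; first by rewrite andbb.
  case: pickP => [c /andP[cb cb']|nc] /=; last by rewrite nc.
  case: eqVneq => [<-|ce]; first by rewrite cb cb'.
  apply/esym/negbTE; apply: contraNN bb' => /andP[eb eb'].
  by rewrite (inc_uniq ce cb eb cb' eb').
- case: ifP => /= c'b; first by case: eqVneq => [<-|]; rewrite ?c'b ?andbF.
  by case: eqVneq => [<-|]; rewrite ?c'b ?andbF.
- case: ifP => /= cb'; first by case: eqVneq => [<-|].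
  by case: eqVneq => [<-|]; rewrite ?cb'.
- case: eqVneq => [->|cc'] /=; first by rewrite andbb.
  by apply/esym; apply: contra_neqF cc' => /andP[/eqP-> /eqP->].
Qed.

HB.instance Definition _ := Order.POrder_MeetJoin_isLattice.Build
  (Order.Disp tt tt) L meet_incP join_incP.

Lemma lt_incE (x y : L) : (x < y) = (x != y) && le_inc x y.
Proof. by rewrite lt_neqAle. Qed.

Hypothesis r_neq0 : forall a, exists c, c \in r a.
Hypothesis r_cover : forall c, exists a, c \in r a.
Hypothesis A_gt0 : (0 < #|A|)%N.

(** [A_gt0] keeps the top from covering the bottom, and [r_cover] keeps a coatom from doing so. *)
Lemma atoms_inc : atoms L = [set atom_inc a | a : A].
Proof.
apply/setP => x; rewrite inE /covers; apply/andP/imsetP => [[x0 nz]|[a _ ->]].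
  case: x x0 nz => [[]|[a|c]] //= _.
  - have /card_gt0P[a _] := A_gt0.
    by case/negP; apply/existsP; exists (atom_inc a).
  - by move=> _; exists a.
  - have [a ca] := r_cover c.
    by case/negP; apply/existsP; exists (atom_inc a); rewrite !lt_incE /= ca.
split=> //; apply/negP => /existsP[z /andP[]]; rewrite !lt_incE.
by case: z => [[]|[b|c]] //=; try (move=> _ /andP[+ /eqP e]; rewrite e eqxx).
Qed.

Lemma coatoms_inc : coatoms L = [set coatom_inc c | c : C].
Proof.
apply/setP => x; rewrite inE /covers; apply/andP/imsetP => [[x0 nz]|[c _ ->]].
  case: x x0 nz => [[]|[a|c]] //= _.
  - have /card_gt0P[a _] := A_gt0.
    by case/negP; apply/existsP; exists (atom_inc a).
  - have [c ca] := r_neq0 a.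
    by case/negP; apply/existsP; exists (coatom_inc c); rewrite lt_incE /= ca.
  - by move=> _; exists c.
split=> //; apply/negP => /existsP[z /andP[]]; rewrite !lt_incE.
by case: z => [[]|[b|c']] //= => /andP[+ /eqP e]; rewrite e eqxx.
Qed.

(** Atoms are pairwise incomparable, and so are coatoms, so a chain contains at most one of each;
    [r_neq0] and [r_cover] supply a missing partner. Every chain thus lies in a flag of four
    elements, which a maximal chain has to fill. *)
Lemma graded_inc : graded_rank3 L.
Proof.
move=> D /maxsetP[chD maxD].
have chainP (x y : L) : x \in D -> y \in D -> x >=< y.
  by move=> xD yD; have /forall_inP/(_ x xD)/forall_inP/(_ y yD) := chD.
have flag a c : c \in r a ->
    let F := [set bot_inc; atom_inc a; coatom_inc c; top_inc] in
    chain F /\ #|F| = 4.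
  move=> ca F; split.
    apply/forall_inP => x; rewrite !inE => xF.
    apply/forall_inP => y; rewrite !inE => yF.
    case/orP: xF => [/orP[/orP[]|]|] /eqP ->;
    case/orP: yF => [/orP[/orP[]|]|] /eqP ->;
    by rewrite /Order.comparable ?le_incE //= ?eqxx ?ca.
  by rewrite /F -!setUA !cardsU1 !inE cards1.
suff [a [c [ca DF]]] : exists a c, c \in r a /\
    D \subset [set bot_inc; atom_inc a; coatom_inc c; top_inc].
  have [chF cF] := flag a c ca.
  by rewrite -(maxD _ chF DF).
have in_flag a c : (forall b, atom_inc b \in D -> b = a) ->
    (forall e, coatom_inc e \in D -> e = c) ->
    D \subset [set bot_inc; atom_inc a; coatom_inc c; top_inc].
  move=> Da Dc; apply/subsetP => -[[]|[b|e]] xD; rewrite !inE ?eqxx ?orbT //.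
    by rewrite (Da b xD) eqxx orbT.
  by rewrite (Dc e xD) eqxx orbT.
have [/existsP[a aD]|/existsPn na] := boolP [exists a, atom_inc a \in D].
  have Da b : atom_inc b \in D -> b = a.
    move=> bD; have := chainP _ _ bD aD.
    by rewrite /Order.comparable !le_incE /= eq_sym orbb => /eqP.
  have [/existsP[c cD]|/existsPn nc] := boolP [exists c, coatom_inc c \in D].
    exists a, c; split.
      have := chainP _ _ aD cD.
      by rewrite /Order.comparable !le_incE /= orbF.
    apply: in_flag => // e eD; have := chainP _ _ eD cD.
    by rewrite /Order.comparable !le_incE /= eq_sym orbb => /eqP.
  have [c ca] := r_neq0 a; exists a, c; split=> //; apply: in_flag => // e eD.
  by have := nc e; rewrite eD.
have [/existsP[c cD]|/existsPn nc] := boolP [exists c, coatom_inc c \in D].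
  have [a ca] := r_cover c; exists a, c; split=> //; apply: in_flag => [b bD|e eD].
    by have := na b; rewrite bD.
  have := chainP _ _ eD cD.
  by rewrite /Order.comparable !le_incE /= eq_sym orbb => /eqP.
have /card_gt0P[a _] := A_gt0; have [c ca] := r_neq0 a.
exists a, c; split=> //; apply: in_flag => [b bD|e eD].
  by have := na b; rewrite bD.
by have := nc e; rewrite eD.
Qed.

Lemma rank3_inc : rank3_lattice L #|C| #|A|.
Proof.
split; first exact: graded_inc.
  by rewrite coatoms_inc card_imset // => c c' [].
by rewrite atoms_inc card_imset // => a a' [].
Qed.

End IncidenceLattice.

(** * Rank 3 lattices up to isomorphism *)

Section IncidenceIso.
Import mathcomp.boot.fintype mathcomp.boot.finset.
Local Open Scope nat_scope.
Local Open Scope set_scope.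
Local Open Scope order_scope.

(** Recognizes atoms and coatoms by the order alone, as the middle of a chain of four, so that any
    isomorphism has to respect the two levels. *)
Lemma inc_flag (A C : finType) (r : A -> {set C}) (rlin : linear_inc r)
    (x y : inc_lat rlin) :
  \bot < x -> x < y -> y < \top ->
  exists a c, x = atom_inc rlin a /\ y = coatom_inc rlin c.
Proof.
rewrite !lt_incE; case: x y => [[]|[a|c]] [[]|[b|c']] //= _.
- by move=> /andP[+ /eqP e]; rewrite e eqxx.
- by exists a, c'.
- by move=> /andP[+ /eqP e]; rewrite e eqxx.
Qed.

(** An isomorphism fixes bottom and top and carries flags to flags, hence splits into a bijection of
    the atoms and a permutation of the coatoms. *)
Lemma isomorphic_inc (A A' C : finType) (r : A -> {set C}) (r' : A' -> {set C})
    (rlin : linear_inc r) (rlin' : linear_inc r') :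
  #|A| = #|A'| ->
  (forall a, exists c, c \in r a) -> (forall c, exists a, c \in r a) ->
  isomorphic (inc_lat rlin) (inc_lat rlin') <->
  exists (g : {perm C}) (p : A -> A'),
    bijective p /\ forall a, r' (p a) = g @: r a.
Proof.
move=> cA r_neq0 r_cover; split=> [[f bf fm]|[g [p [bp rp]]]].
  have f0 : f \bot = \bot.
    by have [k fk kf] := bf; apply/eqP; rewrite -lex0 -[\bot in leRHS]kf fm le0x.
  have f1 : f \top = \top.
    by have [k fk kf] := bf; apply/eqP; rewrite -le1x -[\top in leLHS]kf fm lex1.
  have flt : {mono f : x y / x < y} by exact: leW_mono.
  have finj : injective f by exact: bij_inj.
  have pP a : exists a', f (atom_inc rlin a) = atom_inc rlin' a'.
    have [c ca] := r_neq0 a.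
    have [||| a' [c' [-> _]]] := @inc_flag _ _ _ rlin' (f (atom_inc rlin a))
      (f (coatom_inc rlin c)).
    - by rewrite -f0 flt.
    - by rewrite flt lt_incE /= ca.
    - by rewrite -f1 flt.
    - by exists a'.
  have gP c : exists c', f (coatom_inc rlin c) = coatom_inc rlin' c'.
    have [a ca] := r_cover c.
    have [||| a' [c' [_ ->]]] := @inc_flag _ _ _ rlin' (f (atom_inc rlin a))
      (f (coatom_inc rlin c)).
    - by rewrite -f0 flt.
    - by rewrite flt lt_incE /= ca.
    - by rewrite -f1 flt.
    - by exists c'.
  have [p fp] := fin_all_exists pP; have [g fg] := fin_all_exists gP.
  have pinj : injective p.
    move=> a b pab; have : f (atom_inc rlin a) = f (atom_inc rlin b).
      by rewrite !fp pab.
    by move/finj => [].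
  have ginj : injective g.
    move=> a b gab; have : f (coatom_inc rlin a) = f (coatom_inc rlin b).
      by rewrite !fg gab.
    by move/finj => [].
  exists (perm ginj), p; split; first by apply: inj_card_bij => //; rewrite cA.
  move=> a; apply/setP => c'; rewrite -[c'](permKV (perm ginj)).
  set c := ((perm ginj)^-1)%g c'; rewrite mem_imset; last exact: perm_inj.
  have := fm (atom_inc rlin a) (coatom_inc rlin c).
  by rewrite fp fg permE !le_incE.
have [q pq qp] := bp.
pose f (x : inc_lat rlin) : inc_lat rlin' := match x with
  | inl b => inl b | inr (inl a) => inr (inl (p a)) | inr (inr c) => inr (inr (g c)) end.
pose h (x : inc_lat rlin') : inc_lat rlin := match x with
  | inl b => inl b | inr (inl a) => inr (inl (q a))
  | inr (inr c) => inr (inr ((g^-1)%g c)) end.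
exists f.
  exists h; first by case=> [b|[a|c]] //=; rewrite ?pq ?permK.
  by case=> [b|[a|c]] //=; rewrite ?qp ?permKV.
case=> [[]|[a|c]] [[]|[b|c']] //=; rewrite !le_incE /=.
- by rewrite (can_eq pq).
- by rewrite rp mem_imset //; apply: perm_inj.
- by rewrite (inj_eq perm_inj).
Qed.


Lemma sorted_chain d (L : finTBLatticeType d) (s : seq L) :
  sorted <%O s -> chain [set u in s].
Proof.
rewrite lt_sorted_uniq_le => /andP[_ ss].
apply/forall_inP => u; rewrite inE => us; apply/forall_inP => v; rewrite inE => vs.
rewrite -(nth_index \bot us) -(nth_index \bot vs) /Order.comparable.
by case/orP: (leq_total (index u s) (index v s)) => ?; apply/orP; [left|right];
  apply: le_sorted_leq_nth => //; rewrite inE index_mem.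
Qed.

Section Rank3.
Variables (d : Order.disp_t) (L : finTBLatticeType d).
Hypothesis gL : graded_rank3 L.
Implicit Types x y z : L.

Lemma rank3_sorted_size (s : seq L) : sorted <%O s -> (size s <= 4)%N.
Proof.
move=> ss; have [D maxD sD] := maxset_exists (sorted_chain ss).
rewrite -(gL maxD) -(card_uniqP (lt_sorted_uniq ss)) -(cardsE (mem s)).
exact: subset_leq_card sD.
Qed.

Lemma rank3_lattice_cases x :
  [\/ x = \bot, x = \top, x \in atoms L | x \in coatoms L].
Proof.
have [->|x0] := eqVneq x \bot; first by constructor 1.
have [->|x1] := eqVneq x \top; first by constructor 2.
have [xa|xna] := boolP (x \in atoms L); first by constructor 3.
have [xc|xnc] := boolP (x \in coatoms L); first by constructor 4.
move: xna xnc; rewrite !inE /covers lt0x ltx1 x0 x1 /= !negbK.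
move=> /existsP[z /andP[z0 zx]] /existsP[y /andP[xy y1]].
have := @rank3_sorted_size [:: \bot; z; x; y; \top].
by rewrite /= z0 zx xy y1 => /(_ isT).
Qed.

(** A maximal chain through bottom, [x] and top has four elements, so one of them is none of these
    three. *)
Lemma rank3_between x : exists y, [/\ y != \bot, y != x, y != \top & x >=< y].
Proof.
have [D maxD sD] : {D : {set L} | maxset (@chain _ L) D &
    [set u in [:: \bot; x; \top]] \subset D}.
  apply: maxset_exists; apply/forall_inP => u; rewrite !inE => uP.
  apply/forall_inP => v; rewrite !inE => vP.
  by case/or3P: uP => /eqP->; case/or3P: vP => /eqP->;
    rewrite ?comparablexx // /Order.comparable ?le0x ?lex1 ?orbT.
have : (0 < #|D :\: [set u in [:: \bot; x; \top]]|)%N.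
  rewrite cardsD (setIidPr sD) (gL maxD) subn_gt0 ltnS cardsE.
  exact: leq_trans (card_size _) _.
case/card_gt0P => y; rewrite !inE !negb_or => /andP[/and3P[y0 yx y1] yD].
exists y; split=> //; have /maxsetp := maxD.
move/forall_inP/(_ x)/(_ _)/forall_inP/(_ y yD); apply.
by apply: (subsetP sD); rewrite !inE eqxx orbT.
Qed.

Lemma rank3_atom_le x : x \in atoms L -> exists2 y, y \in coatoms L & x < y.
Proof.
rewrite inE => /andP[x0 /existsPn nx]; have [y [y0 yx y1 xy]] := rank3_between x.
have {}xy : x < y.
  have := nx y; rewrite lt0x y0 /= => yltx.
  by rewrite lt_neqAle eq_sym yx /=; case/orP: xy => // yx';
    rewrite lt_neqAle yx yx' in yltx.
exists y => //; have [e|e|e|//] := rank3_lattice_cases y.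
- by rewrite e eqxx in y0.
- by rewrite e eqxx in y1.
- by move: e; rewrite inE => /andP[_ /existsPn/(_ x)]; rewrite x0 xy.
Qed.

Lemma rank3_coatom_ge x : x \in coatoms L -> exists2 y, y \in atoms L & y < x.
Proof.
rewrite inE => /andP[x1 /existsPn nx]; have [y [y0 yx y1 xy]] := rank3_between x.
have {}xy : y < x.
  have := nx y; rewrite ltx1 y1 andbT => xlty.
  by rewrite lt_neqAle yx /=; case/orP: xy => // yx';
    rewrite lt_neqAle eq_sym yx yx' in xlty.
exists y => //; have [e|e|//|e] := rank3_lattice_cases y.
- by rewrite e eqxx in y0.
- by rewrite e eqxx in y1.
- by move: e; rewrite inE => /andP[_ /existsPn/(_ x)]; rewrite x1 xy.
Qed.

(** This is where joins and meets matter: [x] and [y] have a join below the meet of [u] and [v], so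
    bottom, [x], the join, [u] and top would form a chain of five elements. *)
Lemma rank3_linear x y u v : x \in atoms L -> x != y -> v \in coatoms L ->
  u != v -> x <= u -> x <= v -> y <= u -> y <= v -> y \in atoms L ->
  u \in coatoms L -> False.
Proof.
move=> xa xy vc uv xu xv yu yv ya uc.
have z1 : x `|` y <= u `&` v by rewrite leUx !lexI xu xv yu yv.
have antia a b : a \in atoms L -> b \in atoms L -> a < b -> False.
  rewrite !inE => /andP[a0 _] /andP[_ /existsPn/(_ a)].
  by rewrite a0 /= => /negbTE ->.
have antic a b : a \in coatoms L -> b \in coatoms L -> a < b -> False.
  rewrite !inE => /andP[_ /existsPn/(_ b)] + /andP[b1 _].
  by rewrite b1 andbT => /negbTE ->.
have xz : x < x `|` y.
  rewrite lt_neqAle leUl andbT; apply/eqP => e.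
  by apply: (antia y x) => //; rewrite lt_neqAle eq_sym xy e leUr.
have zu : u `&` v < u.
  rewrite lt_neqAle leIl andbT; apply/eqP => e.
  by apply: (antic u v) => //; rewrite lt_neqAle uv -e leIr.
have := @rank3_sorted_size [:: \bot; x; x `|` y; u; \top].
rewrite /= xz (le_lt_trans z1 zu).
move: xa uc; rewrite !inE => /andP[-> _] /andP[-> _].
by move=> /(_ isT).
Qed.

End Rank3.

Lemma rank3_lattice_inc d (L : finTBLatticeType d) c a :
  rank3_lattice L c a ->
  exists (A : finType) (r : A -> {set 'I_c}) (rlin : linear_inc r),
  [/\ #|A| = a, forall x, exists i, i \in r x, forall i, exists x, i \in r x &
      isomorphic L (inc_lat rlin)].
Proof.
case=> gL cC cA.
pose A := {x : L | x \in atoms L}.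
pose co (i : 'I_c) : L := enum_val (cast_ord (esym cC) i).
have coP i : co i \in coatoms L by exact: enum_valP.
have coinj : injective co by move=> i j /enum_val_inj/cast_ord_inj.
have coE y : y \in coatoms L -> exists i, y = co i.
  move=> yc; exists (cast_ord cC (enum_rank_in yc y)).
  by rewrite /co cast_ordK enum_rankK_in.
pose r (x : A) := [set i | val x <= co i].
have rlin : linear_inc r.
  move=> x y xy; apply/card_le1_eqP => i j; rewrite !inE.
  move=> /andP[xi yi] /andP[xj yj]; apply: contraTeq isT => ij; exfalso.
  apply: (@rank3_linear _ _ gL (val x) (val y) (co i) (co j)) => //.
  - exact: valP x.
  - by rewrite (inj_eq coinj) eq_sym.
  - exact: valP y.
have catoms : #|{: A}| = a by rewrite card_sig -cA; apply: eq_card => x; rewrite !inE.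
exists A, r, rlin; split=> //.
- move=> x; have [y yc xy] := rank3_atom_le gL (valP x).
  by have [i e] := coE _ yc; exists i; rewrite inE -e ltW.
- move=> i; have [x xa xi] := rank3_coatom_ge gL (coP i).
  by exists (exist _ x xa); rewrite inE ltW.
apply: isomorphic_sym.
pose f (x : inc_lat rlin) : L := match x with
  | inl false => \bot | inl true => \top | inr (inl u) => val u | inr (inr i) => co i end.
have a0 (u : A) : \bot < val u by have := valP u; rewrite inE => /andP[].
have c1 i : co i < \top by have := coP i; rewrite inE => /andP[].
have a1 (u : A) : val u < \top.
  by have [y _ uy] := rank3_atom_le gL (valP u); exact: lt_le_trans uy (lex1 _).
have c0 i : \bot < co i.
  by have [y _ yi] := rank3_coatom_ge gL (coP i); exact: le_lt_trans (le0x _) yi.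
have acov (u : A) y : \bot < y -> (y < val u) = false.
  have := valP u; rewrite inE => /andP[_ /existsPn/(_ y)] + y0.
  by rewrite y0 => /negbTE.
have ccov i y : y < \top -> (co i < y) = false.
  have := coP i; rewrite inE => /andP[_ /existsPn/(_ y)] + y1.
  by rewrite y1 andbT => /negbTE.
have fm : {mono f : x y / x <= y}.
  case=> [[]|[u|i]] [[]|[v|j]]; rewrite le_incE /= ?le0x ?lex1 ?lexx //.
  - have [y [y0 _ _ _]] := rank3_between gL \bot.
    by apply: contraNF y0 => /(le_trans (lex1 y)); rewrite lex0.
  - exact/lt_geF/a1.
  - exact/lt_geF/c1.
  - exact/lt_geF/a0.
  - by rewrite le_eqVlt (acov v _ (a0 u)) orbF (inj_eq val_inj).
  - by rewrite inE.
  - exact/lt_geF/c0.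
  (* If the atom [v] were above the coatom [i], a coatom [y] strictly above [v] would be strictly
     above [i]. *)
  - apply/negbTE/negP => iv; have [y yc vy] := rank3_atom_le gL (valP v).
    have := ccov i y; rewrite (le_lt_trans iv vy) => /(_ _)/negP; apply=> //.
    by move: yc; rewrite inE => /andP[].
  - by rewrite le_eqVlt (ccov i _ (c1 j)) orbF (inj_eq coinj).
have finj : injective f.
  by move=> x y e; apply/eqP; rewrite eq_le -!fm e lexx.
exists f => //; apply: inj_card_bij => //.
have fsurj y : exists x, y = f x.
  have [->|->|ya|yc] := rank3_lattice_cases gL y.
  - by exists (bot_inc rlin).
  - by exists (top_inc rlin).
  - by exists (atom_inc rlin (exist _ y ya)).
  - by have [i ->] := coE _ yc; exists (coatom_inc rlin i).
have [h fh] := fin_all_exists fsurj.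
by apply: (@leq_card _ _ h) => x y e; rewrite (fh x) (fh y) e.
Qed.
End IncidenceIso.

(** * Configurations *)

Section Configurations.
Import mathcomp.boot.fintype mathcomp.boot.finset.
Local Open Scope set_scope.
Local Open Scope nat_scope.

Definition linear_space (C : finType) (H : {set {set C}}) : bool :=
  [forall S in H, 1 < #|S|] &&
  [forall S in H, forall S' in H, (S != S') ==> (#|S :&: S'| <= 1)].

(* The least number of atoms that realizes H: every point outside the blocks
   needs an atom of its own. *)
Definition weight (C : finType) (H : {set {set C}}) : nat :=
  #|H| + #|~: cover H|.

Local Notation config C a := ({set {set C}} * {ffun C -> 'I_a.+1})%type.

(** The multiplicities sum to at most [a], so taking them in ['I_a.+1] loses nothing and keeps the
    type finite. *)
Definition configs (C : finType) (a : nat) : {set config C a} :=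
  [set p : config C a | linear_space p.1 & weight p.1 + \sum_i p.2 i == a].

Definition config_perm (C : finType) (a : nat) (p : config C a) (g : {perm C})
    : config C a :=
  ([set g @: (S : {set C}) | S in p.1], [ffun i => p.2 (g^-1%g i)]).

Definition full_inc (A C : finType) (r : A -> {set C}) : Prop :=
  [/\ linear_inc r, forall x, exists i, i \in r x & forall i, exists x, i \in r x].

Definition inc_blocks (A C : finType) (r : A -> {set C}) : {set {set C}} :=
  [set r x | x in [pred x | 1 < #|r x|]].

Definition inc_fibre (A C : finType) (r : A -> {set C}) (S : {set C}) : nat :=
  #|[set x | r x == S]|.

(* The second component counts the atoms below the coatom i only, in excess of
   the one that is forced when i lies in no block. *)
Definition inc_config (A C : finType) a (r : A -> {set C}) : config C a :=
  (inc_blocks r, [ffun i => inord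
     (inc_fibre r [set i] - (i \notin cover (inc_blocks r)))]).

(** An element is sent to the one that has the same position in the enumeration of the corresponding
    fibre. *)
Lemma fibre_injection (A A' : finType) (T : eqType) (f : A -> T) (f' : A' -> T) :
  (forall t, #|[set x | f x == t]| <= #|[set x | f' x == t]|) ->
  exists2 p : A -> A', injective p & forall x, f' (p x) = f x.
Proof.
move=> le_fib.
pose s t := enum [set x | f x == t]; pose s' t := enum [set x | f' x == t].
have s_f x : x \in s (f x) by rewrite mem_enum inE.
have /fin_all_exists[p pP] (x : A) : exists y, y \in s' (f x) /\
    index y (s' (f x)) = index x (s (f x)).
  have ltx : index x (s (f x)) < size (s' (f x)).
    by apply: leq_trans (_ : size (s (f x)) <= _); rewrite ?index_mem // -!cardE.
  have y0 : A' by case: (s' (f x)) ltx.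
  exists (nth y0 (s' (f x)) (index x (s (f x)))).
  by rewrite mem_nth // index_uniq // enum_uniq.
have fp x : f' (p x) = f x.
  by have [] := pP x; rewrite mem_enum inE => /eqP.
exists p => // x y e; have exy : f x = f y by rewrite -!fp e.
have [_ ix] := pP x; have [_ iy] := pP y.
have : index x (s (f x)) = index y (s (f x)) by rewrite -ix e {1}exy iy exy.
by move/(congr1 (nth x (s (f x)))); rewrite !nth_index // exy.
Qed.

Lemma fibre_bijection (A A' : finType) (T : eqType) (f : A -> T) (f' : A' -> T) :
  (forall t, #|[set x | f x == t]| = #|[set x | f' x == t]|) ->
  exists2 p : A -> A', bijective p & forall x, f' (p x) = f x.
Proof.
move=> eq_fib.
have [t|p pinj fp] := @fibre_injection _ _ _ f f'; first by rewrite eq_fib.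
have [t|q qinj _] := @fibre_injection _ _ _ f' f; first by rewrite eq_fib.
by exists p => //; apply: inj_card_bij => //; apply: leq_card qinj.
Qed.

Section IncConfig.
Variables (C : finType) (a : nat).
Implicit Types (A : finType) (p : config C a) (g : {perm C}).

(** Two atoms with the same set [S] would meet in all of [S], so linearity excludes repeated blocks;
    only singletons can carry a multiplicity. *)
Lemma fibre_block A (r : A -> {set C}) (S : {set C}) : linear_inc r -> 1 < #|S| ->
  inc_fibre r S = (S \in inc_blocks r).
Proof.
move=> rlin S2; have [/imsetP[x]|nS] := boolP (S \in _).
  rewrite inE => _ e; apply/eqP/cards1P; exists x; apply/setP => y.
  rewrite !inE; apply/eqP/eqP => [ey|->//]; apply/eqP; apply: contraT => /rlin.
  by rewrite ey -e setIid leqNgt S2.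
apply/eqP; rewrite cards_eq0; apply/eqP/setP => x; rewrite !inE.
by apply: contraNF nS => /eqP e; apply/imsetP; exists x; rewrite ?inE e.
Qed.

Lemma cover_blocks A (r : A -> {set C}) i :
  (i \in cover (inc_blocks r)) = [exists x, (i \in r x) && (1 < #|r x|)].
Proof.
apply/bigcupP/existsP => [[S /imsetP[x]]|[x /andP[ix rx]]].
  by rewrite inE => rx -> ix; exists x; rewrite ix.
by exists (r x) => //; apply/imsetP; exists x; rewrite ?inE.
Qed.

(** Some atom lies below [i]; if no block contains [i], that atom has the set [[set i]]. This makes
    the truncated subtraction in [inc_config] exact. *)
Lemma uncovered_fibre A (r : A -> {set C}) i : full_inc r ->
  (i \notin cover (inc_blocks r)) <= inc_fibre r [set i].
Proof.
case=> _ _ /(_ i)[x ix]; rewrite cover_blocks; case: existsPn => // /(_ x).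
rewrite ix /= -leqNgt => rx1; apply/card_gt0P; exists x; rewrite inE.
by rewrite eq_sym eqEcard sub1set ix cards1.
Qed.

Lemma inc_configP A (r : A -> {set C}) i : full_inc r -> #|A| = a ->
  inc_fibre r [set i] =
  (inc_config a r).2 i + (i \notin cover (inc_blocks r)) :> nat.
Proof.
move=> fr cA; rewrite ffunE inordK; first by rewrite subnK // uncovered_fibre.
by rewrite ltnS (leq_trans (leq_subr _ _)) // -cA max_card.
Qed.

Lemma inc_config_in A (r : A -> {set C}) : full_inc r -> #|A| = a ->
  inc_config a r \in configs C a.
Proof.
move=> fr cA; have [rlin r0 rc] := fr.
rewrite inE; apply/andP; split.
  apply/andP; split; apply/forall_inP => S /imsetP[x]; rewrite inE => rx -> //.
  apply/forall_inP => S' /imsetP[y]; rewrite inE => ry ->.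
  by apply/implyP => nxy; apply: rlin; apply: contraNneq nxy => ->.
rewrite /weight -addnA.
have -> : #|~: cover (inc_blocks r)| + \sum_i (inc_config a r).2 i =
    \sum_i inc_fibre r [set i].
  rewrite -sum1_card big_mkcond -big_split /=; apply: eq_bigr => i _.
  by rewrite (inc_configP i fr cA) addnC inE; case: (_ \in _).
have -> : #|inc_blocks r| = #|[set x | 1 < #|r x|]|.
  rewrite card_in_imset; first by apply: eq_card => x; rewrite !inE.
  move=> x y; rewrite !inE => rx _ e; apply/eqP; apply: contraT => /rlin.
  by rewrite -e setIid leqNgt rx.
rewrite -[X in _ == X]cA -(cardsC [set x | 1 < #|r x|]) eqn_add2l; apply/eqP.
(* The remaining atoms lie below a single coatom, which [h] has to choose; sorting them by [h] gives
   the singleton fibres. *)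
have [h hr] := fin_all_exists r0.
rewrite -sum1_card (partition_big h predT) //=.
apply: eq_bigr => i _; rewrite -[LHS]sum1_card; apply: eq_bigl => x.
rewrite !inE -leqNgt; apply/eqP/andP => [e|[rx /eqP <-]].
  by have := hr x; rewrite e inE cards1 => /eqP ->.
by apply/eqP; rewrite eq_sym eqEcard sub1set hr cards1.
Qed.

(** The configuration determines the size of every fibre: zero over the empty set, the multiplicity
    plus the forced 1 over a singleton, and membership in the blocks over a larger set. *)
Lemma inc_config_eq A A' (r : A -> {set C}) (r' : A' -> {set C}) :
  full_inc r -> full_inc r' -> #|A| = a -> #|A'| = a ->
  inc_config a r = inc_config a r' ->
  exists2 q : A -> A', bijective q & forall x, r' (q x) = r x.
Proof.
move=> fr fr' cA cA' e; apply: fibre_bijection => S.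
rewrite -!/(inc_fibre _ _).
have eH : inc_blocks r = inc_blocks r' by move/(congr1 fst): e.
have [S1|S1|/eqP/cards1P[i ->]] := ltngtP #|S| 1.
- suff fib0 (B : finType) (f : B -> {set C}) : full_inc f -> inc_fibre f S = 0.
    by rewrite !fib0.
  case=> _ f0 _; apply/eqP; rewrite cards_eq0; apply/eqP/setP => x; rewrite !inE.
  have [i ix] := f0 x; apply: contraTF ix => /eqP ->.
  by move: S1; rewrite ltnS leqn0 cards_eq0 => /eqP ->; rewrite inE.
- by have [rl _ _] := fr; have [rl' _ _] := fr'; rewrite !fibre_block // eH.
- by rewrite (inc_configP i fr cA) (inc_configP i fr' cA') e eH.
Qed.

Lemma inc_config_perm A A' (r : A -> {set C}) (r' : A' -> {set C}) g (q : A -> A') :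
  bijective q -> (forall x, r' (q x) = g @: r x) ->
  inc_config a r' = config_perm (inc_config a r) g.
Proof.
move=> [q' qq' q'q] rq.
have eH : inc_blocks r' = [set g @: (S : {set C}) | S in inc_blocks r].
  apply/setP => S; apply/imsetP/imsetP => [[y]|[T /imsetP[x]]].
    rewrite inE => y2 ->; exists (r (q' y)); last by rewrite -rq q'q.
    apply/imsetP; exists (q' y) => //; rewrite inE.
    by rewrite -(card_imset _ (@perm_inj _ g)) -rq q'q.
  rewrite inE => x2 -> ->; exists (q x); last by rewrite rq.
  by rewrite inE rq card_imset //; apply: perm_inj.
congr pair => //; apply/ffunP => i; rewrite !ffunE; congr inord; congr subn.
  have fE : [set x | r' x == [set i]] = q @: [set x | r x == [set (g^-1)%g i]].
    apply/setP => y; rewrite -[y]q'q mem_imset ?inE; last exact: can_inj qq'.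
    by rewrite rq -{1}[i](permKV g) -imset_set1 (inj_eq (imset_inj perm_inj)).
  by rewrite /inc_fibre fE card_imset //; apply: can_inj qq'.
rewrite eH; congr (nat_of_bool (~~ _)); apply/bigcupP/bigcupP => [[S]|[T TH iT]].
  case/imsetP => T TH -> iT; exists T => //.
  by rewrite -(mem_imset _ _ (@perm_inj _ g)) permKV.
exists (g @: T); first by apply/imsetP; exists T.
by rewrite -[i](permKV g) mem_imset //; apply: perm_inj.
Qed.

Lemma full_inc_perm A (r : A -> {set C}) g :
  full_inc r -> full_inc (fun x => g @: r x).
Proof.
case=> rlin r0 rc; split=> [x y xy|x|i].
- rewrite -imsetI ?card_imset ?rlin //; first exact: perm_inj.
  by move=> ? ? _ _; apply: perm_inj.
- by have [i ix] := r0 x; exists (g i); apply: imset_f.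
- have [x ix] := rc (g^-1 i)%g; exists x.
  by rewrite -[i](permKV g) imset_f.
Qed.

Lemma isomorphic_config A A' (r : A -> {set C}) (r' : A' -> {set C})
    (rlin : linear_inc r) (rlin' : linear_inc r') :
  full_inc r -> full_inc r' -> #|A| = a -> #|A'| = a ->
  isomorphic (inc_lat rlin) (inc_lat rlin') <->
  exists g, inc_config a r' = config_perm (inc_config a r) g.
Proof.
move=> fr fr' cA cA'; have [_ r0 rc] := fr.
have [to fro] := isomorphic_inc rlin rlin' (etrans cA (esym cA')) r0 rc; split.
  by move/to => [g [q [bq rq]]]; exists g; apply: inc_config_perm rq.
case=> g e; apply: fro; exists g.
have frg := full_inc_perm g fr.
have [||||| q bq rq] := @inc_config_eq _ _ (fun x => g @: r x) r' => //.
  by rewrite e; apply: (@inc_config_perm _ _ _ _ g id); first by exists id.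
by exists q.
Qed.

Lemma inc_config_surj p : p \in configs C a ->
  exists (A : finType) (r : A -> {set C}),
  [/\ full_inc r, #|A| = a & inc_config a r = p].
Proof.
case: p => H m; rewrite inE /= => /andP[/andP[/forall_inP H2 /forall_inP Hlin] /eqP sumH].
(* The realization has one atom for each block and [n i] atoms below [i] alone, the forced one
   included. *)
pose n i := m i + (i \notin cover H).
pose A : finType := ({T : {set C} | T \in H} + {i : C & 'I_(n i)})%type.
pose r (x : A) : {set C} := match x with inl U => val U | inr j => [set tag j] end.
have rlin : linear_inc r.
  case=> [U|i] [T|j] xy; first last.
  - by rewrite (leq_trans (subset_leq_card (subsetIl _ _))) ?cards1.
  - by rewrite (leq_trans (subset_leq_card (subsetIl _ _))) ?cards1.
  - by rewrite (leq_trans (subset_leq_card (subsetIr _ _))) ?cards1.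
  by have /forall_inP/(_ _ (valP T))/implyP := Hlin _ (valP U); apply.
have fr : full_inc r.
  split=> // [[U|j]|i].
  - by have /ltnW/card_gt0P[i iS] := H2 _ (valP U); exists i.
  - by exists (tag j); rewrite inE.
  - have [/bigcupP[S SH iS]|ni] := boolP (i \in cover H).
      by exists (inl (exist _ S SH)).
    have n0 : 0 < n i by rewrite /n ni addn1.
    by exists (inr (Tagged (fun i => 'I_(n i)) (Ordinal n0))); rewrite inE.
have cA : #|A| = a.
  rewrite card_sum card_sig card_tagged -sumH /weight -addnA; congr addn.
  rewrite sumnE big_map big_enum /=.
  rewrite -[#|~: _|]sum1_card [in RHS]big_mkcond -big_split /=.
  apply: eq_big => // i _.
  by rewrite card_ord /n addnC inE; case: (_ \in _).
exists A, r; split=> //.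
have eH : inc_blocks r = H.
  apply/setP => S; apply/imsetP/idP => [[[T|j]]|SH].
  - by rewrite inE => _ ->; apply: valP.
  - by rewrite inE /= cards1.
  - by exists (inl (exist _ S SH)); rewrite // inE H2.
congr pair => //; apply/ffunP => i; apply: val_inj; apply/eqP.
rewrite -(eqn_add2r (i \notin cover (inc_blocks r))).
rewrite -[X in X == _](inc_configP i fr cA) eH -/(n i) /inc_fibre.
rewrite -[X in _ == X]card_ord.
pose h (k : 'I_(n i)) : A := inr (Tagged (fun i => 'I_(n i)) k).
have hinj : injective h.
  by move=> k l [] /eqP; rewrite -tag_eqE /tag_eq eqxx /= tagged_asE => /eqP.
rewrite -(card_imset predT hinj); apply/eqP/eq_card => x; rewrite inE.
apply/eqP/imsetP => [|[k _ ->] //].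
case: x => [U e|[j k] /set1_inj e].
  by have := H2 _ (valP U); rewrite (e : val U = _) cards1.
by rewrite /= in e; subst j; exists k.
Qed.

End IncConfig.
End Configurations.

(** * Burnside's lemma for the action on configurations *)

Section Burnside.
Import mathcomp.boot.fintype mathcomp.boot.finset mathcomp.fingroup.action.
Local Open Scope set_scope.
Local Open Scope nat_scope.
Local Notation config C a := ({set {set C}} * {ffun C -> 'I_a.+1})%type.

Lemma card_Fix_conj (aT : finGroupType) (rT : finType)
    (to : {action aT &-> rT}) (S : {set rT}) (g h : aT) :
  {acts [set: aT], on S | to} ->
  #|'Fix_(S | to)[g ^ h]%g| = #|'Fix_(S | to)[g]%g|.
Proof.
move=> actS; rewrite -(card_imset ('Fix_(S | to)[g]%g) (act_inj to h)).
apply: eq_card => x; rewrite -[x](actKV to h); move: (to x h^-1%g) => y.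
rewrite (mem_imset _ _ (act_inj to h)) !inE actS ?inE // !sub1set !inE.
rewrite conjgE -!actM mulKVg actM; congr andb.
by apply/eqP/eqP => [/(act_inj to h)|->].
Qed.

Section ConfigAction.
Variables (C : finType) (a : nat).
Implicit Types (p : config C a) (g h : {perm C}).

Lemma config_perm1 p : config_perm p 1%g = p.
Proof.
case: p => H m; congr pair; last by apply/ffunP => i; rewrite ffunE invg1 perm1.
rewrite -[RHS]imset_id; apply: eq_imset => S.
by rewrite -[RHS]imset_id; apply: eq_imset => i; rewrite perm1.
Qed.

Lemma config_permM p g h :
  config_perm p (g * h)%g = config_perm (config_perm p g) h.
Proof.
case: p => H m; congr pair; last first.
  by apply/ffunP => i; rewrite !ffunE invMg permM.
rewrite /= -imset_comp; apply: eq_imset => S /=.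
by rewrite -imset_comp; apply: eq_imset => i; rewrite /= permM.
Qed.

Definition config_action := TotalAction config_perm1 config_permM.

(** Linearity and weight of the image need no separate computation: a relation realizing the
    configuration is relabelled, and the result is again the configuration of a relation. *)
Lemma configs_act : [acts [set: {perm C}], on configs C a | config_action].
Proof.
apply/subsetP => g _; rewrite !inE; apply/subsetP => p pC; rewrite inE /=.
have [A [r [fr cA <-]]] := inc_config_surj pC.
rewrite -(@inc_config_perm _ _ _ _ r (fun x => g @: r x) g id) //; last by exists id.
by apply: inc_config_in => //; apply: full_inc_perm.
Qed.

Definition config_orbits : {set {set config C a}} :=
  orbit config_action [set: {perm C}] @: configs C a.

Definition fix_configs g : nat := #|'Fix_(configs C a | config_action)[g]%g|.

Lemma burnside_configs :
  #|config_orbits| * #|{perm C}| = \sum_(g : {perm C}) fix_configs g.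
Proof.
rewrite -cardsT -(Frobenius_Cauchy configs_act).
by apply: eq_bigl => g; rewrite inE.
Qed.

Lemma fix_configs_conj g h : fix_configs (g ^ h)%g = fix_configs g.
Proof. by apply: card_Fix_conj; apply/actsP/configs_act. Qed.

Definition invariant_space g (H : {set {set C}}) : bool :=
  linear_space H && ([set g @: (S : {set C}) | S in H] == H).

Definition invariant_sums g (s : nat) : nat :=
  #|[set m : {ffun C -> 'I_a.+1} |
     [forall i, m (g i) == m i] & \sum_i m i == s :> nat]|.

Lemma fix_configsE g : fix_configs g =
  \sum_(H | invariant_space g H && (weight H <= a)) invariant_sums g (a - weight H).
Proof.
under eq_bigr do rewrite /invariant_sums -sum1_card.
rewrite pair_big_dep /fix_configs -[LHS]sum1_card; apply: eq_bigl => -[H m].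
rewrite !inE sub1set !inE /= /invariant_space.
case: (linear_space H) => //=.
have -> : (config_perm (H, m) g == (H, m)) =
    ([set g @: (S : {set C}) | S in H] == H) && [forall i, m (g i) == m i].
  rewrite xpair_eqE; congr andb; apply/eqP/forallP => [/ffunP e i|e].
    by rewrite -e ffunE permK.
  by apply/ffunP => i; rewrite ffunE -[in RHS](permKV g i) (eqP (e _)).
have -> : (weight H + \sum_i m i == a) =
    (weight H <= a) && (\sum_i m i == a - weight H).
  move: (\sum_i m i) => k.
  by apply/eqP/andP => [<-|[wa /eqP->]]; rewrite ?leq_addr ?addKn // subnKC.
by rewrite andbC andbACA.
Qed.

End ConfigAction.

(** Every orbit contains the configuration of some relation, whose lattice serves as its
    representative. [0 < c] provides a coatom and hence an atom below it. *)
Theorem num_iso_classes_orbits c a : 0 < c ->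
  num_iso_classes c a #|config_orbits 'I_c a|.
Proof.
move=> c0; pose C := 'I_c.
have /fin_all_exists[s sP] (i : 'I_#|config_orbits 'I_c a|) :
    exists s : {A : finType & {r : A -> {set C} | linear_inc r}},
      [/\ full_inc (sval (tagged s)), #|tag s| = a &
       enum_val i = orbit (config_action C a) [set: {perm C}]
         (inc_config a (sval (tagged s)))].
  have /imsetP[p pC ->] := enum_valP i.
  have [A [r [fr cA <-]]] := inc_config_surj pC.
  have [rlin _ _] := fr.
  by exists (Tagged (fun A : finType => {r : A -> {set C} | linear_inc r})
    (exist _ r rlin)).
pose L i := inc_lat (svalP (tagged (s i))).
have A0 i : 0 < #|tag (s i)|.
  have [[_ _ rc] _ _] := sP i; have [x _] := rc (Ordinal c0).
  by apply/card_gt0P; exists x.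
exists (fun=> Order.Disp tt tt), (fun i => L i); split.
- move=> i; have [[_ r0 rc] cA _] := sP i.
  by have := rank3_inc (svalP (tagged (s i))) r0 rc (A0 i); rewrite card_ord cA.
- move=> i j; have [fr cA ei] := sP i; have [fr' cA' ej] := sP j.
  case/(isomorphic_config _ _ fr fr' cA cA') => g e.
  apply: enum_val_inj; rewrite ei ej; apply/esym/orbit_eqP/orbitP.
  by exists g; rewrite ?inE // e.
- move=> d M /rank3_lattice_inc[A [r [rlin [cA r0 rc isoM]]]].
  have fr : full_inc r by [].
  have oM : orbit (config_action C a) [set: {perm C}] (inc_config a r)
      \in config_orbits 'I_c a.
    by apply/imsetP; exists (inc_config a r) => //; apply: inc_config_in.
  exists (enum_rank_in oM
    (orbit (config_action C a) [set: {perm C}] (inc_config a r))).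
  set i := enum_rank_in _ _; have [fr' cA' e] := sP i.
  apply: isomorphic_trans isoM _; apply/(isomorphic_config _ _ fr fr' cA cA').
  have : inc_config a (sval (tagged (s i))) \in
      orbit (config_action C a) [set: {perm C}] (inc_config a r).
    by rewrite -(enum_rankK_in oM oM) e orbit_refl.
  by case/orbitP => g _ <-; exists g.
Qed.

End Burnside.

(** * Enumeration of the invariant linear spaces *)

Section SubSequences.
Import mathcomp.boot.fintype mathcomp.boot.finset.
Local Open Scope nat_scope.

Fixpoint subs (T : Type) (s : seq T) : seq (seq T) :=
  if s is x :: s' then subs s' ++ map (cons x) (subs s') else [:: [::]].

Lemma mem_subs (T : eqType) (s l : seq T) : (l \in subs s) = subseq l s.
Proof.
elim: s l => [|x s IH] l /=; first by rewrite inE.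
rewrite mem_cat IH; case: l => [|y l]; first by rewrite sub0seq.
have -> : (y :: l \in map (cons x) (subs s)) = (y == x) && subseq l s.
  apply/mapP/andP => [[l' + [-> ->]]|[/eqP -> ls]]; first by rewrite IH.
  by exists l; rewrite ?IH.
case: eqP => //= _; last by rewrite orbF.
apply/orb_idl; exact/subseq_trans/subseq_cons.
Qed.

Lemma subs_uniq (T : eqType) (s : seq T) : uniq s -> uniq (subs s).
Proof.
elim: s => //= x s IH /andP[xs us]; rewrite cat_uniq IH // map_inj_uniq ?IH //;
  last first.
  by move=> l l' [].
rewrite andbT; apply/hasPn => l /mapP[l' _ ->]; rewrite mem_subs.
by apply: contra xs => /mem_subseq; apply; rewrite inE eqxx.
Qed.

Section CliqueSum.
Variables (T St : Type) (compat : rel T) (upd : St -> T -> St) (f : St -> BinNums.N).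

(** Branches on the head of the list: it is left out, or it is taken and the candidates incompatible
    with it are dropped. The fuel is there because the filtered tail is not a structural subterm. *)
Fixpoint clique_sum (fuel : nat) (s : seq T) (st : St) : BinNums.N :=
  match fuel, s with
  | fuel'.+1, x :: s' => BinNat.N.add (clique_sum fuel' s' st)
      (clique_sum fuel' [seq y <- s' | compat x y] (upd st x))
  | _, _ => f st
  end.

Lemma sum_subs_filter (p : pred T) (Q : pred (seq T)) (F : seq T -> nat) s :
  \sum_(l <- subs [seq x <- s | p x] | Q l) F l =
  \sum_(l <- subs s | all p l && Q l) F l.
Proof.
elim: s Q F => [|x s IH] Q F; first by rewrite /= !big_cons !big_nil.
rewrite /=; case: ifP => px; rewrite /= ?big_cat !big_map /= !IH /=.
  by rewrite px.
rewrite px /= [X in _ = _ + X]big_pred0 ?addn0 //.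
Qed.

Lemma clique_sumE fuel s st : size s <= fuel ->
  BinNat.N.to_nat (clique_sum fuel s st) =
  \sum_(l <- subs s | pairwise compat l) BinNat.N.to_nat (f (foldl upd st l)).
Proof.
elim: fuel s st => [|fuel IH] [|x s] st //=;
  rewrite ?big_cons ?big_nil ?addn0 //= ltnS => ss.
rewrite Nnat.N2Nat.inj_add !IH //;
  last by rewrite (leq_trans _ ss) // size_filter count_size.
by rewrite big_cat big_map /= sum_subs_filter.
Qed.

End CliqueSum.
End SubSequences.

(** * Blocks as bit sequences and their orbits under a permutation *)

Section BitBlocks.
Import mathcomp.boot.fintype mathcomp.boot.finset.
Local Open Scope set_scope.
Local Open Scope nat_scope.
Variable n : nat.
Implicit Types (b : bitseq) (S : {set 'I_n}).

Definition set_of b : {set 'I_n} := [set i : 'I_n | nth false b i].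
Definition bits_of S : bitseq := [seq i \in S | i <- enum 'I_n].

Lemma bits_ofK S : set_of (bits_of S) = S.
Proof.
apply/setP => i; rewrite inE (nth_map i) ?size_enum_ord //.
by rewrite nth_ord_enum.
Qed.

Lemma set_ofK b : size b = n -> bits_of (set_of b) = b.
Proof.
move=> sb; apply: (@eq_from_nth _ false); rewrite size_map size_enum_ord // => i lt_in.
rewrite (nth_map (Ordinal lt_in)) ?size_enum_ord // inE.
by rewrite nth_enum_ord.
Qed.

Lemma card_set_of b : size b = n -> #|set_of b| = count id b.
Proof.
move=> sb; rewrite -sum1_card big_mkcond /= -[b in RHS](set_ofK sb) -sum1_count.
rewrite big_map big_enum_cond /= [RHS]big_mkcond; apply: eq_bigr => i _.
by [].
Qed.

Definition meet_bits b b' : bitseq := [seq p.1 && p.2 | p <- zip b b'].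

Lemma set_of_meet b b' : size b = n -> size b' = n ->
  set_of (meet_bits b b') = set_of b :&: set_of b'.
Proof.
move=> sb sb'; apply/setP => i; rewrite !inE (nth_map (false, false)).
  by rewrite nth_zip ?sb.
by rewrite size_zip sb sb' minnn.
Qed.

Definition bits_ok b b' : bool := count id (meet_bits b b') <= 1.

Lemma bits_okE b b' : size b = n -> size b' = n ->
  bits_ok b b' = (#|set_of b :&: set_of b'| <= 1).
Proof.
move=> sb sb'; rewrite -set_of_meet // card_set_of //.
by rewrite size_map size_zip sb sb' minnn.
Qed.

(* [gi] is the inverse of the permutation. *)
Definition perm_bits (gi : nat -> nat) b : bitseq :=
  [seq nth false b (gi i) | i <- iota 0 n].

Lemma set_of_perm (g : {perm 'I_n}) (gi : nat -> nat) b :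
  (forall i : 'I_n, gi i = (g^-1)%g i) ->
  set_of (perm_bits gi b) = g @: set_of b.
Proof.
move=> gE; apply/setP => i; rewrite inE (nth_map 0) ?size_iota //.
rewrite nth_iota // add0n gE -[in RHS](permKV g i) mem_imset ?inE //.
exact: perm_inj.
Qed.

Fixpoint bitseqs m : seq bitseq :=
  if m is m'.+1 then map (cons true) (bitseqs m') ++ map (cons false) (bitseqs m')
  else [:: [::]].

Lemma mem_bitseqs m b : size b = m -> b \in bitseqs m.
Proof.
elim: m b => [|m IH] [|c b] //= [/IH bm]; rewrite mem_cat.
by case: c; rewrite map_f ?orbT.
Qed.

(* Large blocks come first because they exclude the most candidates. *)
Definition big_blocks : seq bitseq :=
  sort (fun b b' => count id b' <= count id b)
    [seq b <- bitseqs n | 1 < count id b].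

(** An orbit is listed once, from its block of least index in [big_blocks]. [k] is meant to be the
    order of the permutation, and [undup] shortens the smaller orbits. *)
Definition block_orbits (gi : nat -> nat) (k : nat) : seq (seq bitseq) :=
  [seq undup (traject (perm_bits gi) b k) | b <- big_blocks &
    all (fun c => index b big_blocks <= index c big_blocks)
      (traject (perm_bits gi) b k)].

(** The last clause says that each list is closed under the permutation and generated by any of its
    blocks. Empty lists are forbidden because every space would contain all their blocks, so they
    could not be recovered from the space. *)
Definition wf_orbits (gi : nat -> nat) (k : nat) (gs : seq (seq bitseq)) : bool :=
  [&& uniq gs, uniq (flatten gs),
   all (fun b => (size b == n) && (1 < count id b)) (flatten gs),
   all [in flatten gs] big_blocks &
   all (fun c => (c != [::]) && all (fun b => (perm_bits gi b \in c) &&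
         all [in traject (perm_bits gi) b k] c) c) gs].

Definition orbit_compat (c d : seq bitseq) : bool := allrel bits_ok c d.

Definition orbits_space (l : seq (seq bitseq)) : {set {set 'I_n}} :=
  [set S in map set_of (flatten l)].

Section Invariant.
Variables (g : {perm 'I_n}) (gi : nat -> nat) (k : nat) (gs : seq (seq bitseq)).
Hypothesis gE : forall i : 'I_n, gi i = (g^-1)%g i.
Hypothesis wf : wf_orbits gi k gs.

(** An orbit two of whose own blocks conflict cannot occur in any invariant linear space. *)
Let ok_gs := [seq c <- gs | pairwise bits_ok c].

Let size_gs b : b \in flatten gs -> size b = n.
Proof. by have /and5P[_ _ /allP + _ _] := wf; move=> h /h /andP[/eqP]. Qed.

Let count_gs b : b \in flatten gs -> 1 < count id b.
Proof. by have /and5P[_ _ /allP + _ _] := wf; move=> h /h /andP[]. Qed.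

Let mem_sub l b : subseq l ok_gs -> b \in flatten l -> b \in flatten gs.
Proof.
move=> /mem_subseq sl /flattenP[c /sl cl bc]; apply/flattenP; exists c => //.
by move: cl; rewrite mem_filter => /andP[].
Qed.

Let block_gs S : 1 < #|S| -> bits_of S \in flatten gs.
Proof.
have sS : size (bits_of S) = n by rewrite size_map size_enum_ord.
move=> S2; have /and5P[_ _ _ /allP bb _] := wf; apply: bb.
by rewrite mem_sort mem_filter mem_bitseqs // -card_set_of // bits_ofK S2.
Qed.

Let gs_eq c d b : c \in gs -> d \in gs -> b \in c -> b \in d -> c = d.
Proof.
have /and5P[_ + _ _ _] := wf; elim: (gs) => //= e s IH; rewrite cat_uniq.
move=> /and3P[_ /hasPn ns us]; rewrite !inE.
move=> /predU1P[->|cs] /predU1P[->|ds] be bd //; last exact: IH.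
  by have := ns b; rewrite be => /(_ _)/negP; case=> //; apply/flattenP; exists d.
by have := ns b; rewrite bd => /(_ _)/negP; case=> //; apply/flattenP; exists c.
Qed.

Let orbits_of (H : {set {set 'I_n}}) :=
  [seq c <- ok_gs | all (fun b => set_of b \in H) c].

Lemma pairwise_flatten (T : Type) (r : rel T) (l : seq (seq T)) :
  pairwise r (flatten l) = all (pairwise r) l && pairwise (allrel r) l.
Proof.
elim: l => //= c l IH; rewrite pairwise_cat IH.
have -> : allrel r c (flatten l) = all (allrel r c) l.
  by elim: l {IH} => [|d l IH] /=; rewrite ?allrel0r // allrel_catr IH.
by rewrite -!andbA; do !bool_congr.
Qed.

Lemma pairwise_in (T : eqType) (r : rel T) (s : seq T) : symmetric r ->
  pairwise r s -> {in s &, forall x y, x != y -> r x y}.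
Proof.
move=> rs; elim: s => //= x s IH /andP[/allP rx ps] y z; rewrite !inE.
move=> /predU1P[->|ys] /predU1P[->|zs]; rewrite ?eqxx //.
- by move=> _; apply: rx.
- by move=> _; rewrite rs; apply: rx.
- exact: IH.
Qed.

Lemma set_of_inj b b' : size b = n -> size b' = n -> set_of b = set_of b' -> b = b'.
Proof. by move=> sb sb' e; rewrite -(set_ofK sb) e set_ofK. Qed.

Let pairwise_ok (H : {set {set 'I_n}}) s : linear_space H -> uniq s ->
  {subset s <= flatten gs} -> all (fun b => set_of b \in H) s ->
  pairwise bits_ok s.
Proof.
move=> /andP[_ /forall_inP linH]; rewrite uniq_pairwise => us sgs /allP sH.
apply: (sub_in_pairwise (P := mem s)) us; last exact/allP.
move=> b b' bs bs' /= nbb'; rewrite bits_okE ?size_gs ?sgs //.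
have /forall_inP/(_ _ (sH _ bs'))/implyP := linH _ (sH _ bs); apply.
apply: contra nbb' => /eqP/set_of_inj -> //; apply: size_gs; exact: sgs.
Qed.

Let orbits_ofK (H : {set {set 'I_n}}) : invariant_space g H ->
  orbits_space (orbits_of H) = H.
Proof.
move=> /andP[linH /eqP invH]; apply/setP => S; rewrite inE; apply/mapP/idP.
  by case=> b /flattenP[c]; rewrite mem_filter => /andP[/allP cH _] /cH + ->.
move=> SH; have S2 : 1 < #|S| by move: linH => /andP[/forall_inP/(_ _ SH)].
have /flattenP[c cgs bc] := block_gs S2.
exists (bits_of S); last by rewrite bits_ofK.
apply/flattenP; exists c => //.
(* Each block of the orbit generates all of it, so invariance of [H] brings in the whole orbit along
   with [S]. *)
have cH : all (fun b => set_of b \in H) c.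
  have /and5P[_ _ _ _ /allP/(_ _ cgs)/andP[_ /allP/(_ _ bc)/andP[_ /allP ct]]] := wf.
  apply/allP => b /ct /trajectP[i _ ->].
  elim: i => [|i IH]; first by rewrite bits_ofK.
  by rewrite iterS (set_of_perm _ gE) -invH imset_f.
have sub_c : {subset c <= flatten gs} by move=> b bc'; apply/flattenP; exists c.
rewrite !mem_filter cgs cH /= andbT; apply: pairwise_ok linH _ _ cH => //.
have /and5P[_ + _ _ _] := wf.
elim: (gs) cgs => //= d s IH; rewrite inE cat_uniq => /predU1P[<-|/IH h] /and3P[] //.
Qed.

Let orbits_spaceK l : subseq l ok_gs -> orbits_of (orbits_space l) = l.
Proof.
move=> sl; have /and5P[ugs _ _ _ /allP wfc] := wf.
have uok : uniq ok_gs by apply: filter_uniq.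
have e := subseq_uniqP uok sl; rewrite [RHS]e; apply: eq_in_filter => c.
rewrite mem_filter => /andP[_ cgs]; apply/allP/idP => [cl|cl b bc]; last first.
  by rewrite inE map_f //; apply/flattenP; exists c.
have /andP[c0 _] := wfc c cgs.
have [b bc] : exists b, b \in c by case: (c) c0 => // b c' _; exists b; rewrite inE eqxx.
have := cl b bc; rewrite inE => /mapP[b' b'l].
move/set_of_inj; rewrite !size_gs; last first.
- by apply/flattenP; exists c.
- exact: mem_sub b'l.
move=> /(_ erefl erefl) ebb'; have /flattenP[d dl b'd] := b'l.
have dgs : d \in gs by have := mem_subseq sl dl; rewrite mem_filter => /andP[].
by rewrite (gs_eq cgs dgs bc) // ebb'.
Qed.

Let uniq_flatten l : subseq l gs -> uniq (flatten l).
Proof.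
have /and5P[_ + _ _ _] := wf; elim: (gs) l => [|c s IH] [|d l] //=.
rewrite cat_uniq => /and3P[uc /hasPn cs us]; case: eqP => [->|_] sl; last exact: IH sl.
rewrite cat_uniq uc IH // andbT; apply/hasPn => b /flattenP[e el be]; apply: cs.
by apply/flattenP; exists e => //; apply: mem_subseq el.
Qed.

Let sub_gs l : subseq l ok_gs -> subseq l gs.
Proof. by move=> sl; apply: subseq_trans sl (filter_subseq _ _). Qed.

Let orbits_space_inv l : subseq l ok_gs -> pairwise orbit_compat l ->
  invariant_space g (orbits_space l).
Proof.
move=> sl pl; have ul := uniq_flatten (sub_gs sl).
have szl b : b \in flatten l -> size b = n by move=> bl; apply/size_gs/(mem_sub sl).
have okl : {in flatten l &, forall b b', b != b' -> bits_ok b b'}.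
  apply: pairwise_in.
    move=> b b'; rewrite /bits_ok /meet_bits; congr (_ <= _).
    elim: b b' => [|x b IH] [|x' b'] //=; by rewrite andbC IH.
  rewrite pairwise_flatten pl andbT; apply/allP => c /(mem_subseq sl).
  by rewrite mem_filter => /andP[].
apply/andP; split; first (apply/andP; split).
- apply/forall_inP => S; rewrite inE => /mapP[b bl ->].
  by rewrite card_set_of ?szl // count_gs // (mem_sub sl).
- apply/forall_inP => S; rewrite inE => /mapP[b bl ->].
  apply/forall_inP => S'; rewrite inE => /mapP[b' bl' ->].
  apply/implyP => nbb'; rewrite -bits_okE ?szl //; apply: okl => //.
  by apply: contraNneq nbb' => ->.
(* The permutation acts injectively on blocks, so one inclusion suffices. *)
rewrite eqEcard card_imset; last exact: imset_inj perm_inj.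
rewrite leqnn andbT; apply/subsetP => S /imsetP[T]; rewrite inE.
case/mapP => b /flattenP[c cl bc] -> ->; rewrite inE.
have cgs : c \in gs by exact: mem_subseq (sub_gs sl) _ cl.
have /and5P[_ _ _ _ /allP/(_ _ cgs)/andP[_ /allP/(_ _ bc)/andP[gb _]]] := wf.
by rewrite -(set_of_perm _ gE) map_f //; apply/flattenP; exists c.
Qed.

Let orbits_of_sub H : invariant_space g H ->
  subseq (orbits_of H) ok_gs && pairwise orbit_compat (orbits_of H).
Proof.
move=> invH; rewrite filter_subseq /=; have /andP[linH _] := invH.
have sub : subseq (orbits_of H) ok_gs := filter_subseq _ _.
have := pairwise_ok linH (uniq_flatten (sub_gs sub)).
rewrite pairwise_flatten => /(_ _ _)/andP[] //.
  by move=> b; apply: mem_sub.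
apply/allP => b /flattenP[c]; rewrite mem_filter => /andP[/allP cH _]; exact: cH.
Qed.

(** An invariant space is a union of orbits: [orbits_of] and [orbits_space] are inverse bijections
    between invariant spaces and pairwise compatible sublists of [ok_gs]. *)
Lemma sum_invariant_space (F : {set {set 'I_n}} -> nat) :
  \sum_(H | invariant_space g H) F H =
  \sum_(l <- subs ok_gs | pairwise orbit_compat l) F (orbits_space l).
Proof.
have /and5P[ugs _ _ _ _] := wf.
have perm_orb : perm_eq [seq orbits_of H | H <- enum [pred H | invariant_space g H]]
    [seq l <- subs ok_gs | pairwise orbit_compat l].
  apply: uniq_perm.
  - rewrite map_inj_in_uniq ?enum_uniq // => H H'; rewrite !mem_enum => iH iH' e.
    by rewrite -(orbits_ofK iH) e orbits_ofK.
  - by rewrite filter_uniq // subs_uniq // filter_uniq.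
  - move=> l; rewrite mem_filter mem_subs; apply/mapP/andP => [[H]|[pl sl]].
      by rewrite mem_enum => /orbits_of_sub/andP[? ?] ->.
    by exists (orbits_space l); rewrite ?mem_enum ?inE ?orbits_space_inv ?orbits_spaceK.
rewrite -[RHS]big_filter -(perm_big _ perm_orb) big_map big_enum /=.
by apply: eq_bigr => H iH; rewrite orbits_ofK.
Qed.

(** The state is the number of blocks taken so far with the mask of the points still uncovered,
    which is all that the weight depends on. *)
Definition add_block (st : nat * bitseq) b : nat * bitseq :=
  (st.1.+1, [seq p.1 && ~~ p.2 | p <- zip st.2 b]).

Definition add_orbit := foldl add_block.

Definition state_weight (st : nat * bitseq) : nat := st.1 + count id st.2.

Let foldl_add st s : size st.2 = n -> (forall b, b \in s -> size b = n) ->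
  let st' := foldl add_block st s in
  [/\ st'.1 = st.1 + size s, size st'.2 = n &
     forall i, i < n ->
       nth false st'.2 i = nth false st.2 i && ~~ has (nth false ^~ i) s].
Proof.
elim: s st => [|b s IH] st sst ss; first by split; rewrite ?addn0 //= => i; rewrite andbT.
have sb : size b = n by rewrite ss ?inE ?eqxx.
have s2 : size (add_block st b).2 = n by rewrite size_map size_zip sst sb minnn.
have [||e1 e2 e3] := IH (add_block st b) => //.
  by move=> c cs; rewrite ss // inE cs orbT.
split=> //; first by rewrite e1 addSnnS.
move=> i lt_in; rewrite e3 // (nth_map (false, false)) ?size_zip ?sst ?sb ?minnn //.
by rewrite nth_zip ?sst //= negb_or andbA.
Qed.

Let weight_orbits l : subseq l ok_gs ->
  weight (orbits_space l) = state_weight (foldl add_orbit (0, nseq n true) l).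
Proof.
move=> sl; have szl b : b \in flatten l -> size b = n.
  by move=> bl; apply/size_gs/(mem_sub sl).
have -> : foldl add_orbit (0, nseq n true) l =
    foldl add_block (0, nseq n true) (flatten l).
  by elim: (l) (0, _) => //= c l' IH st; rewrite foldl_cat IH.
have [|e1 e2 e3] := @foldl_add (0, nseq n true) _ _ szl; first exact: size_nseq.
rewrite /state_weight e1 -card_set_of //; congr addn.
  rewrite cardsE -[RHS](size_map set_of); apply/card_uniqP.
  rewrite map_inj_in_uniq ?uniq_flatten ?sub_gs // => b b' bl bl'.
  by apply: set_of_inj; apply: szl.
apply: eq_card => i; rewrite !inE e3 // nth_nseq ltn_ord /=; congr negb.
apply/bigcupP/hasP => [[S]|[b bl ib]].
  by rewrite inE => /mapP[b bl ->]; rewrite inE => ib; exists b.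
by exists (set_of b); rewrite inE ?map_f.
Qed.

Definition weight_moment (j : nat) : BinNums.N :=
  clique_sum orbit_compat add_orbit
    (fun st => BinNat.N.pow (BinNat.N.of_nat (state_weight st)) (BinNat.N.of_nat j))
    (size ok_gs) ok_gs (0, nseq n true).

Lemma weight_momentE (j : nat) :
  \sum_(H | invariant_space g H) weight H ^ j =
  BinNat.N.to_nat (weight_moment j).
Proof.
rewrite sum_invariant_space clique_sumE // big_seq_cond [RHS]big_seq_cond.
apply: eq_bigr => l /andP[]; rewrite mem_subs => /weight_orbits -> _.
rewrite Nnat.N2Nat.inj_pow !Nnat.Nat2N.id; elim: (j) => //= m IH.
by rewrite expnS IH -multE.
Qed.

End Invariant.
End BitBlocks.

(** * Conjugacy classes of the symmetric group *)

Section CycleBound.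
Import mathcomp.boot.fintype mathcomp.boot.finset.
Local Open Scope set_scope.
Local Open Scope nat_scope.
Variables (C : finType) (a : nat) (g : {perm C}).

Lemma invariant_iter (T : Type) (m : C -> T) x y :
  (forall i, m (g i) = m i) -> y \in porbit g x -> m y = m x.
Proof.
move=> mg /porbitP[k ->]; elim: k => [|k IH]; first by rewrite expg0 perm1.
by rewrite expgSr permM mg IH.
Qed.

(** The values at [u] and [v] determine [m]: given two such functions, the one that is smaller at
    [w] is smaller everywhere, and their sums agree. The three cycles need not be distinct. *)
Lemma invariant_sums_le (u v w : C) s :
  (forall x, [|| x \in porbit g u, x \in porbit g v | x \in porbit g w]) ->
  invariant_sums a g s <= a.+1 ^ 2.
Proof.
move=> cov; rewrite /invariant_sums; set X := [set m | _ & _].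
pose f (m : {ffun C -> 'I_a.+1}) := (m u, m v).
suff finj : {in X &, injective f}.
  rewrite -(card_in_imset finj); apply: leq_trans (max_card _) _.
  by rewrite card_prod card_ord mulnn.
have le m m' : m \in X -> m' \in X -> f m = f m' -> m w <= m' w -> m = m'.
  rewrite !inE => /andP[/forallP im /eqP sm] /andP[/forallP im' /eqP sm'] [eu ev] lew.
  have {}im i : m (g i) = m i by apply/eqP.
  have {}im' i : m' (g i) = m' i by apply/eqP.
  have le_m i : m i <= m' i.
    by case/or3P: (cov i) => /[dup] /(invariant_iter im) -> /(invariant_iter im') -> //;
      rewrite ?eu ?ev.
  apply/ffunP => i; apply/val_inj/eqP; rewrite /= eqn_leq le_m /=.
  have := sm; rewrite -sm' (bigD1 i) //= [in RHS](bigD1 i) //=.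
  have : \sum_(j | j != i) m j <= \sum_(j | j != i) m' j by apply: leq_sum.
  by move=> + e; rewrite -(leq_add2l (m i)) e leq_add2r.
move=> m m' mX mX' e; case/orP: (leq_total (m w) (m' w)) => ?; first exact: le.
by apply/esym/le.
Qed.

Lemma fix_configs_le (u v w : C) :
  (forall x, [|| x \in porbit g u, x \in porbit g v | x \in porbit g w]) ->
  fix_configs a g <= #|{set {set C}}| * a.+1 ^ 2.
Proof.
move=> cov; rewrite fix_configsE -sum_nat_const.
rewrite big_mkcond; apply: leq_sum => H _; case: ifP => // _.
exact: invariant_sums_le cov.
Qed.

End CycleBound.

Section Sym6.
Import mathcomp.boot.fintype mathcomp.boot.finset.
Local Open Scope set_scope.
Local Open Scope nat_scope.

(** The list of values, on which tests over the whole symmetric group can be evaluated. *)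
Definition perm_seq n (g : 'S_n) : seq nat := [seq val (g i) | i <- enum 'I_n].

Lemma nth_perm_seq n (g : 'S_n) (i : 'I_n) : nth 0 (perm_seq g) i = g i.
Proof. by rewrite (nth_map i) ?size_enum_ord // nth_ord_enum. Qed.

Lemma perm_seq_inj n : injective (@perm_seq n).
Proof.
by move=> g h e; apply/perm.permP => i; apply: val_inj; rewrite /= -!nth_perm_seq e.
Qed.

Lemma perm_seqs n :
  perm_eq [seq perm_seq g | g : 'S_n] (permutations (iota 0 n)).
Proof.
have uS : uniq [seq perm_seq g | g : 'S_n].
  by rewrite map_inj_uniq ?enum_uniq //; apply: perm_seq_inj.
have sub : {subset [seq perm_seq g | g : 'S_n] <= permutations (iota 0 n)}.
  move=> l /mapP[g _ ->]; rewrite mem_permutations.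
  rewrite /perm_seq; apply: uniq_perm; rewrite ?iota_uniq //.
    by rewrite map_inj_uniq ?enum_uniq // => i j /val_inj/perm_inj.
  move=> j; rewrite mem_iota /=; apply/mapP/idP => [[i _ ->] //|lt_jn].
  exists ((g^-1)%g (Ordinal lt_jn)); rewrite ?mem_enum //= permKV //.
apply: uniq_perm => //; first exact: permutations_uniq.
suff le_size : size (permutations (iota 0 n)) <= size [seq perm_seq g | g : 'S_n].
  by case: (uniq_min_size uS sub le_size).
by rewrite size_permutations ?iota_uniq // size_iota size_map -cardT /= card_Sn.
Qed.

Definition seq_perm n (l : seq nat) : 'S_n := odflt 1%g [pick g | perm_seq g == l].

Lemma seq_permK n (l : seq nat) :
  perm_eq l (iota 0 n) -> perm_seq (seq_perm n l) = l.
Proof.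
rewrite -mem_permutations -(perm_mem (perm_seqs n)) => /mapP[g _ ->].
by rewrite /seq_perm; case: pickP => [h /eqP //|/(_ g)]; rewrite eqxx.
Qed.

Definition id6 : seq nat := [:: 0; 1; 2; 3; 4; 5].
Definition transp6 : seq nat := [:: 1; 0; 2; 3; 4; 5].
Definition cycle6 : seq nat := [:: 1; 2; 0; 3; 4; 5].
Definition double6 : seq nat := [:: 1; 0; 3; 2; 4; 5].

Definition reps6 := [:: id6; transp6; cycle6; double6].

(* The position in [reps6] of the conjugate of l, or 4 if l has at most three
   cycles. *)
Definition class6 (l : seq nat) : nat :=
  let fixed := count (fun i => nth 0 l i == i) (iota 0 6) in
  if fixed == 6 then 0 else if fixed == 4 then 1 else if fixed == 3 then 2 else
  if (fixed == 2) && all (fun i => nth 0 l (nth 0 l i) == i) (iota 0 6) then 3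
  else 4.

(** [mins] holds the least point of each cycle. With fewer than three cycles [nth] falls back on the
    point 0, which merely repeats a cycle. *)
Definition few_cycles6 (l : seq nat) : bool :=
  let orb i := traject (nth 0 l) i 6 in
  let mins := [seq i <- iota 0 6 | all (leq i) (orb i)] in
  all (fun x => [|| x \in orb (nth 0 mins 0), x \in orb (nth 0 mins 1)
                  | x \in orb (nth 0 mins 2)]) (iota 0 6) && all (ltn^~ 6) mins.

Definition conj_seq6 (h r l : seq nat) : bool :=
  all (fun i => nth 0 l (nth 0 h i) == nth 0 h (nth 0 r i)) (iota 0 6).

Definition check6 (ps : seq (seq nat)) : bool :=
  all (fun l => if class6 l < 4 then
    has (fun h => conj_seq6 h (nth [::] reps6 (class6 l)) l) ps
    else few_cycles6 l) ps.

(** The conjugating permutations are found by exhaustive search, which replaces any argument on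
    cycle types. *)
Lemma check6P : check6 (permutations (iota 0 6)).
Proof. by vm_compute. Qed.

Lemma perm_seq_in n (g : 'S_n) : perm_seq g \in permutations (iota 0 n).
Proof. by rewrite -(perm_mem (perm_seqs n)) map_f ?mem_enum. Qed.

Lemma conj_seq6P (g h r : 'S_6) :
  conj_seq6 (perm_seq h) (perm_seq r) (perm_seq g) -> g = (r ^ h)%g.
Proof.
move=> /allP ch; apply/perm.permP => i; rewrite conjgE !permM -{1}[i](permKV h).
set j := (h^-1)%g i; have /eqP : nth 0 (perm_seq g) (nth 0 (perm_seq h) j) ==
    nth 0 (perm_seq h) (nth 0 (perm_seq r) j) by apply: ch; rewrite mem_iota /=.
by rewrite !nth_perm_seq => /val_inj.
Qed.

Lemma traject_perm_seq n (g : 'S_n) (i : 'I_n) k x :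
  x \in traject (nth 0 (perm_seq g)) i k ->
  exists2 j : 'I_n, j = x :> nat & j \in porbit g i.
Proof.
case/trajectP => m _ ->; exists ((g ^+ m)%g i); last exact: mem_porbit.
elim: m => [|m IH]; first by rewrite expg0 perm1.
by rewrite expgSr permM iterS -IH nth_perm_seq.
Qed.

Lemma few_cycles6P (g : 'S_6) : few_cycles6 (perm_seq g) ->
  exists u v w : 'I_6,
    forall x, [|| x \in porbit g u, x \in porbit g v | x \in porbit g w].
Proof.
rewrite /few_cycles6; set mins := [seq i <- _ | _] => /andP[/allP cov /allP lt6].
have lt_mins k : nth 0 mins k < 6.
  have [ks|ks] := ltnP k (size mins); last by rewrite nth_default.
  exact/lt6/mem_nth.
exists (Ordinal (lt_mins 0)), (Ordinal (lt_mins 1)), (Ordinal (lt_mins 2)) => x.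
have orbP k : nat_of_ord x \in traject (nth 0 (perm_seq g)) (nth 0 mins k) 6 ->
    x \in porbit g (Ordinal (lt_mins k)).
  by case/(@traject_perm_seq _ g (Ordinal (lt_mins k))) => j /val_inj <-.
have := cov x; rewrite mem_iota ltn_ord => /(_ isT).
by case/or3P => /orbP ->; rewrite ?orbT.
Qed.

Lemma count_perm_seq n (P : pred (seq nat)) :
  #|[set g : 'S_n | P (perm_seq g)]| = count P (permutations (iota 0 n)).
Proof.
rewrite -(seq.permP (perm_seqs n)) -sum1_card -sum1_count big_map big_enum_cond /=.
by apply: eq_bigl => g; rewrite inE.
Qed.

Lemma sum_class6 (F : 'S_6 -> nat) B :
  (forall g h : 'S_6, F (g ^ h)%g = F g) ->
  (forall (g : 'S_6) u v w,
    (forall x, [|| x \in porbit g u, x \in porbit g v | x \in porbit g w]) ->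
    F g <= B) ->
  exists2 E, E <= 720 * B & \sum_g F g =
    F (seq_perm 6 id6) + 15 * F (seq_perm 6 transp6)
    + 40 * F (seq_perm 6 cycle6) + 45 * F (seq_perm 6 double6) + E.
Proof.
move=> Fconj Fle.
have /allP check := check6P.
exists (\sum_(g : 'S_6 | class6 (perm_seq g) >= 4) F g).
  rewrite -[720]/(6`!) -card_Sn -sum_nat_const big_mkcond.
  apply: leq_sum => g _; case: ltnP => // cg.
  have := check _ (perm_seq_in g); rewrite ltnNge cg /=.
  by case/few_cycles6P => u [v [w cov]]; apply: Fle cov.
have class_sum k : k < 4 -> \sum_(g : 'S_6 | class6 (perm_seq g) == k) F g =
    nth 0 [:: 1; 15; 40; 45] k * F (seq_perm 6 (nth [::] reps6 k)).
  (* The class sizes are confirmed by counting lists. *)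
  move=> k4; have -> : nth 0 [:: 1; 15; 40; 45] k =
      count (fun l => class6 l == k) (permutations (iota 0 6)).
    by case: k k4 => [|[|[|[|]]]] // _; vm_compute.
  rewrite -count_perm_seq -sum_nat_const; apply: eq_big => g.
    by rewrite inE.
  move=> /eqP ck; have := check _ (perm_seq_in g); rewrite ck k4.
  have rK : perm_seq (seq_perm 6 (nth [::] reps6 k)) = nth [::] reps6 k.
    by apply: seq_permK; case: k k4 {ck} => [|[|[|[|]]]].
  case/hasP => h; rewrite mem_permutations => /seq_permK hK.
  by rewrite -{1}hK -{1}rK => /conj_seq6P {1}->; apply: Fconj.
have -> : \sum_g F g = \sum_(g : 'S_6 | class6 (perm_seq g) < 4) F g +
    \sum_(g : 'S_6 | class6 (perm_seq g) >= 4) F g.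
  by rewrite (bigID (fun g => class6 (perm_seq g) < 4)); congr addn;
    apply: eq_bigl => g; rewrite -leqNgt.
have sumE (k : 'I_4) : \sum_(g : 'S_6 | (class6 (perm_seq g) < 4) &&
     (inord (class6 (perm_seq g)) == k)) F g = 
    nth 0 [:: 1; 15; 40; 45] k * F (seq_perm 6 (nth [::] reps6 k)).
  rewrite -class_sum //; apply: eq_bigl => g.
  apply/andP/eqP => [[c4 /eqP <-]|e]; first by rewrite inordK.
  by rewrite e ltn_ord inord_val.
congr addn; transitivity (\sum_(k < 4)
    nth 0 [:: 1; 15; 40; 45] k * F (seq_perm 6 (nth [::] reps6 k))).
  rewrite (partition_big (fun g => inord (class6 (perm_seq g)) : 'I_4) predT) //.
  by apply: eq_bigr => k _; apply: sumE.
rewrite -(big_mkord xpredT (fun k =>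
  nth 0 [:: 1; 15; 40; 45] k * F (seq_perm 6 (nth [::] reps6 k)))).
have addE (m1 m2 m3 m4 : nat) :
  1 * m1 + (m2 + (m3 + (m4 + 0))) = m1 + m2 + m3 + m4 by rewrite mul1n addn0 !addnA.
rewrite /index_iota [iota _ _]/= !big_cons big_nil; exact: addE.
Qed.
End Sym6.

(** * Denumerants *)

Section Denumerants.
Import mathcomp.boot.fintype mathcomp.boot.finset.
Local Open Scope set_scope.
Local Open Scope nat_scope.

Fixpoint dot (ks l : seq nat) : nat :=
  if (ks, l) is (k :: ks', t :: l') then k * t + dot ks' l' else 0.

Fixpoint sols (ks : seq nat) (s : nat) : seq (seq nat) :=
  if ks is k :: ks' then
    [seq t :: l | t <- [seq t <- iota 0 s.+1 | k * t <= s], l <- sols ks' (s - k * t)]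
  else if s is 0 then [:: [::]] else [::].

Lemma sols_cons k ks s : sols (k :: ks) s =
  [seq t :: l | t <- [seq t <- iota 0 s.+1 | k * t <= s], l <- sols ks (s - k * t)].
Proof. by []. Qed.

(** The coefficient of [x^s] in the product of the series [1 / (1 - x^k)] for [k] in [ks]. *)
Definition denumerant (ks : seq nat) (s : nat) : nat := size (sols ks s).

Lemma mem_sols ks s l : all (ltn 0) ks ->
  (l \in sols ks s) = (size l == size ks) && (dot ks l == s).
Proof.
elim: ks s l => [|k ks IH] s l.
  by move=> _; case: l => [|t l]; case: s.
rewrite sols_cons => /andP[k0 ks0]; apply/allpairsPdep/andP => [[t [l' [+ + ->]]]|[]].
  rewrite mem_filter IH // => /andP[kt _] /andP[sl /eqP dl]; rewrite /= eqSS sl.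
  by rewrite dl subnKC.
case: l => // t l; rewrite [dot _ _]/= => /eqP[sl] /eqP ds; exists t, l; split=> //.
  rewrite mem_filter mem_iota /= add0n ltnS -ds leq_addr /=.
  by rewrite (leq_trans _ (leq_addr _ _)) // leq_pmull.
by rewrite IH // sl -ds addKn !eqxx.
Qed.

Lemma sols_uniq ks s : uniq (sols ks s).
Proof.
elim: ks s => [|k ks IH] s; first by case: s.
rewrite sols_cons; apply: allpairs_uniq_dep; first by rewrite filter_uniq ?iota_uniq.
  by move=> t _; apply: IH.
by move=> [t l] [t' l'] _ _ /= [-> ->].
Qed.

Lemma denumerant_cons k ks s : denumerant (k :: ks) s =
  \sum_(t < s.+1 | k * t <= s) denumerant ks (s - k * t).
Proof.
rewrite /denumerant sols_cons size_allpairs_dep sumnE big_map big_filter.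
rewrite -(big_mkord (fun t => k * t <= s) (fun t => size (sols ks (s - k * t)))).
by rewrite /index_iota subn0.
Qed.

(** Splits by whether the unknown of coefficient [k] is zero; for the generating function this is
    multiplication by [1 - x^k]. *)
Lemma denumerant_rec k ks s : 0 < k -> k <= s ->
  denumerant (k :: ks) s = denumerant ks s + denumerant (k :: ks) (s - k).
Proof.
move=> k0 ks0; rewrite !denumerant_cons big_mkcond big_ord_recl /= muln0 subn0.
congr addn; rewrite -big_mkcond /= /bump /=.
rewrite -(big_mkord (fun t => k * (1 + t) <= s)
  (fun t => denumerant ks (s - k * (1 + t)))).
rewrite -(big_mkord (fun t => k * t <= s - k) (fun t => denumerant ks (s - k - k * t))).
rewrite (@big_cat_nat _ _ _ (s - k).+1) //=;
  last by rewrite ltn_subLR // -[X in X < _]add0n ltn_add2r.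
rewrite [X in _ + X]big_nat_cond [X in _ + X]big_pred0 ?addn0; last first.
  move=> t; apply/negP => /andP[/andP[lt_t _]]; apply/negP.
  by rewrite -ltnNge mulnDr muln1 -ltn_subLR // (leq_trans lt_t) // leq_pmull.
apply: eq_big => t; first by rewrite mulnDr muln1 leq_subRL.
by rewrite mulnDr muln1 subnDA.
Qed.

Lemma denumerant_small k ks s : s < k -> denumerant (k :: ks) s = denumerant ks s.
Proof.
move=> sk; rewrite denumerant_cons big_mkcond big_ord_recl /= muln0 subn0.
rewrite big1 ?addn0 // => t _.
by case: ifP => //; rewrite leqNgt (leq_trans sk) // leq_pmulr.
Qed.

(** The recursion for [k = 1] is Pascal's rule. *)
Lemma denumerant_ones n s : denumerant (nseq n.+1 1) s = 'C(s + n, n).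
Proof.
elim: n s => [|n IHn].
  elim=> [|s IH] //; rewrite /= denumerant_rec // bin0 subn1 /= IH.
  by rewrite bin0.
elim=> [|s IH]; first by rewrite /= denumerant_small // IHn !binn.
by rewrite /= denumerant_rec // IHn subn1 /= IH !addSn !addnS binS addnC.
Qed.

Lemma dot_count (pl : seq nat) r (F : nat -> nat) : all (ltn^~ r) pl ->
  \sum_(x <- pl) F x =
  dot [seq count_mem j pl | j <- iota 0 r] [seq F j | j <- iota 0 r].
Proof.
have dotE (s : seq nat) (G : nat -> nat) :
    dot (map G s) (map F s) = \sum_(j <- s) G j * F j.
  by elim: s => [|x s IH] /=; rewrite ?big_nil // big_cons IH.
rewrite dotE; elim: pl => [|x pl IH] /=.
  by rewrite big_nil big1_seq // => j _; rewrite mul0n.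
move=> /andP[xr /IH e]; rewrite big_cons e.
under [in RHS]eq_bigr do rewrite mulnDl.
rewrite big_split /=; congr addn.
rewrite (bigD1_seq x) ?iota_uniq ?mem_iota //= eqxx mul1n big1 ?addn0 // => j.
by rewrite eq_sym => /negbTE ->.
Qed.

(* gl lists the images of a permutation, reps has one point in each cycle, pl maps
   each point to the index of its cycle, and ks lists the cycle lengths. *)
Definition wf_cycles n (gl reps pl ks : seq nat) : bool :=
  [&& size pl == n, ks == [seq count_mem j pl | j <- iota 0 (size ks)],
      all (ltn 0) ks, all (ltn^~ n) reps,
      [seq nth 0 pl i | i <- reps] == iota 0 (size ks) &
      all (fun i => [&& nth 0 pl i < size ks, nth 0 pl (nth 0 gl i) == nth 0 pl i &
        i \in traject (nth 0 gl) (nth 0 reps (nth 0 pl i)) n]) (iota 0 n)].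

(** An invariant function amounts to its values at the cycle representatives, and its sum weights
    each value by the length of the cycle. *)
Lemma invariant_sums_denumerant n a s (g : 'S_n.+1) (gl reps pl ks : seq nat) :
  (forall i : 'I_n.+1, g i = nth 0 gl i :> nat) ->
  wf_cycles n.+1 gl reps pl ks -> s <= a ->
  invariant_sums a g s = denumerant ks s.
Proof.
move=> gE /and5P[/eqP spl /eqP ksE ks0 /allP reps_n /andP[/eqP repsE /allP cycP]] sa.
have sreps : size reps = size ks by rewrite -(size_iota 0 (size ks)) -repsE size_map.
have cyc (i : 'I_n.+1) : [/\ nth 0 pl i < size ks, nth 0 pl (g i) = nth 0 pl i &
    val i \in traject (nth 0 gl) (nth 0 reps (nth 0 pl i)) n.+1].
  have i_in : val i \in iota 0 n.+1 by rewrite mem_iota ltn_ord.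
  by have /and3P[h1 /eqP h2 h3] := cycP _ i_in; split; rewrite ?gE.
have all_pl : all (ltn^~ (size ks)) pl.
  by apply/(all_nthP 0) => i; rewrite spl => lt_in; have [] := cyc (Ordinal lt_in).
have reps_lt j : j < size ks -> nth 0 reps j < n.+1.
  by move=> jk; apply: reps_n; rewrite mem_nth ?sreps.
have pl_reps j : j < size ks -> nth 0 pl (nth 0 reps j) = j.
  by move=> jk; rewrite -(nth_map 0 0) ?sreps // repsE nth_iota.
have pl_iter k (x : 'I_n.+1) : nth 0 pl (iter k g x) = nth 0 pl x.
  by elim: k => //= k <-; have [] := cyc (iter k g x).
have rep_inv (m : {ffun 'I_n.+1 -> 'I_a.+1}) (i : 'I_n.+1) : (forall i, m (g i) = m i) ->
    m i = m (inord (nth 0 reps (nth 0 pl i))).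
  move=> mg; have [pli _ /trajectP[k _ e]] := cyc i.
  have -> : i = iter k g (inord (nth 0 reps (nth 0 pl i))).
    apply: val_inj; rewrite [LHS]e; elim: k {e} => [|k IH].
      by rewrite /= inordK ?reps_lt.
    by rewrite !iterS IH; apply/esym/gE.
  rewrite [in RHS](_ : nth 0 pl _ = nth 0 pl i).
    by elim: k {e} => [|k IH] //=; rewrite mg.
  by rewrite pl_iter inordK ?reps_lt // pl_reps.
pose f (m : {ffun 'I_n.+1 -> 'I_a.+1}) : seq nat := [seq val (m (inord j)) | j <- reps].
have nth_f m j : j < size ks -> nth 0 (f m) j = m (inord (nth 0 reps j)).
  by move=> jk; rewrite (nth_map 0) ?sreps.
have sum_dot (F : nat -> nat) :
    \sum_(i < n.+1) F (nth 0 pl i) = dot ks [seq F j | j <- iota 0 (size ks)].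
  rewrite {1}ksE -dot_count // -(big_mkord predT (fun i => F (nth 0 pl i))) -spl.
  by rewrite [RHS](big_nth 0).
rewrite /invariant_sums cardE -(size_map f) /denumerant; apply: perm_size.
apply: uniq_perm; [|exact: sols_uniq|].
- rewrite map_inj_in_uniq ?enum_uniq // => m m'; rewrite !mem_enum !inE.
  move=> /andP[/forallP im _] /andP[/forallP im' _] e; apply/ffunP => i.
  have [pli _ _] := cyc i; apply: val_inj.
  rewrite (rep_inv m) => [|j]; last exact/eqP.
  rewrite (rep_inv m') => [|j]; last exact/eqP.
  by rewrite /= -!nth_f // e.
move=> l; rewrite mem_sols //; apply/mapP/andP => [[m]|[/eqP sl /eqP dl]].
  rewrite mem_enum inE => /andP[/forallP im /eqP sm] ->.
  split; first by rewrite size_map sreps.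
  have {}im i : m (g i) = m i by apply/eqP.
  rewrite -sm; apply/eqP/esym.
  under eq_bigr => i _ do rewrite (rep_inv m i im).
  rewrite (sum_dot (fun j => m (inord (nth 0 reps j)))); congr dot.
  by apply: (@eq_from_nth _ 0); rewrite !size_map size_iota ?sreps // => j jk;
    rewrite (nth_map 0) ?size_iota // nth_iota // add0n nth_f.
(* Each coefficient is at least 1, so no unknown exceeds [s]; with [s <= a] the values fit in
   ['I_a.+1]. *)
have l_small j : j < size ks -> nth 0 l j < a.+1.
  move=> jk; rewrite ltnS (leq_trans _ sa) // -dl.
  elim: (ks) (l) j sl jk ks0 {dl} => [|k ks' IH] [|t l'] // [|j] /= [sl] jk /andP[k0 ks0].
    by rewrite (leq_trans _ (leq_addr _ _)) // leq_pmull.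
  by rewrite (leq_trans _ (leq_addl _ _)) // IH.
pose m : {ffun 'I_n.+1 -> 'I_a.+1} := [ffun i : 'I_n.+1 => inord (nth 0 l (nth 0 pl i))].
exists m; last first.
  apply: (@eq_from_nth _ 0); rewrite ?size_map ?sreps // => j; rewrite sl => jk.
  by rewrite nth_f // ffunE !inordK ?pl_reps ?l_small ?reps_lt.
rewrite mem_enum inE; apply/andP; split.
  by apply/forallP => i; rewrite !ffunE; have [_ -> _] := cyc i.
rewrite -[X in _ == X]dl; apply/eqP.
have -> : dot ks l = dot ks [seq nth 0 l j | j <- iota 0 (size ks)].
  by rewrite -sl -/(mkseq _ _) mkseq_nth.
rewrite -sum_dot; apply: eq_bigr => i _; rewrite ffunE inordK //.
by apply: l_small; have [] := cyc i.
Qed.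

End Denumerants.

(** * Asymptotics *)

Section Approximation.
Local Open Scope ring_scope.
Variable K : realFieldType.
Implicit Types (F G : nat -> K) (c : K).

(** Explicit witnesses keep the estimates within ordered field arithmetic; the passage to Landau
    notation is made once, in [approx_bigO]. *)
Definition approx F c5 c4 c3 : Prop := exists C N, forall a, (N <= a)%N ->
  `|F a - (c5 * a%:R ^+ 5 + c4 * a%:R ^+ 4 + c3 * a%:R ^+ 3)| <= C * a%:R ^+ 2.

Lemma approx_eq F G c5 c4 c3 N : (forall a, (N <= a)%N -> F a = G a) ->
  approx F c5 c4 c3 -> approx G c5 c4 c3.
Proof.
move=> FG [C [M h]]; exists C, (maxn N M) => a; rewrite geq_max => /andP[Na Ma].
by rewrite -FG // h.
Qed.

Lemma approx_coef F c5 c4 c3 d5 d4 d3 : approx F c5 c4 c3 ->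
  c5 = d5 -> c4 = d4 -> c3 = d3 -> approx F d5 d4 d3.
Proof. by move=> h <- <- <-. Qed.

Lemma approx_add F G c5 c4 c3 d5 d4 d3 :
  approx F c5 c4 c3 -> approx G d5 d4 d3 ->
  approx (fun a => F a + G a) (c5 + d5) (c4 + d4) (c3 + d3).
Proof.
move=> [C [M hF]] [D [N hG]]; exists (C + D), (maxn M N) => a.
rewrite geq_max => /andP[/hF hFa /hG hGa]; rewrite [leRHS]mulrDl.
apply: le_trans _ (lerD hFa hGa); apply: le_trans _ (ler_normD _ _).
by rewrite le_eqVlt; apply/orP; left; apply/eqP; congr `|_|; ring.
Qed.

Lemma approx_scale x F c5 c4 c3 : approx F c5 c4 c3 ->
  approx (fun a => x * F a) (x * c5) (x * c4) (x * c3).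
Proof.
move=> [C [M hF]]; exists (`|x| * C), M => a /hF hFa.
rewrite (_ : _ - _ =
  x * (F a - (c5 * a%:R ^+ 5 + c4 * a%:R ^+ 4 + c3 * a%:R ^+ 3))); last by ring.
by rewrite normrM -mulrA; apply: ler_wpM2l.
Qed.

Lemma approx_small F B : (forall a, `|F a| <= B * a.+1%:R ^+ 2) -> approx F 0 0 0.
Proof.
move=> hF; exists (B * 4), 1%N => a a1.
have B0 : 0 <= B by have := hF 0%N; rewrite expr1n mulr1; apply: le_trans.
rewrite !mul0r !addr0 subr0 -mulrA; apply: le_trans (hF a) _.
apply: ler_wpM2l => //.
have : 1 <= a%:R :> K by rewrite ler1n.
by rewrite -natr1; nra.
Qed.

Lemma approx_sum (I : Type) (r : seq I) (P : pred I) (F : I -> nat -> K)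
    (c5 c4 c3 : I -> K) :
  (forall i, approx (F i) (c5 i) (c4 i) (c3 i)) ->
  approx (fun a => \sum_(i <- r | P i) F i a) (\sum_(i <- r | P i) c5 i)
    (\sum_(i <- r | P i) c4 i) (\sum_(i <- r | P i) c3 i).
Proof.
move=> h; elim: r => [|i r IH].
  rewrite !big_nil; apply: (@approx_small _ 0) => a.
  by rewrite big_nil normr0 mul0r.
rewrite !big_cons; case: ifP => Pi.
  apply: (@approx_eq _ _ _ _ _ 0%N) (approx_add (h i) IH) => a _.
  by rewrite big_cons Pi.
by apply: (@approx_eq _ _ _ _ _ 0%N) IH => a _; rewrite big_cons Pi.
Qed.

(** The new coefficients come from the binomial expansion of [(a - 1)^5] and [(a - 1)^4]; the
    truncation of [a.-1] at 0 is invisible for large [a]. *)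
Lemma approx_pred F c5 c4 c3 : approx F c5 c4 c3 ->
  approx (fun a => F a.-1) c5 (c4 - 5 * c5) (c3 - 4 * c4 + 10 * c5).
Proof.
move=> [C [N hF]]; exists (`|C| + 16 * `|c5| + 11 * `|c4| + 7 * `|c3|), N.+1.
case=> // a /hF; rewrite /= -natr1; set y : K := a%:R => hFa.
have y0 : 0 <= y by rewrite ler0n.
have -> : F a - (c5 * (y + 1) ^+ 5 + (c4 - 5 * c5) * (y + 1) ^+ 4 +
    (c3 - 4 * c4 + 10 * c5) * (y + 1) ^+ 3) =
  (F a - (c5 * y ^+ 5 + c4 * y ^+ 4 + c3 * y ^+ 3)) -
  (c5 * (10 * y ^+ 2 + 15 * y + 6) - c4 * (6 * y ^+ 2 + 8 * y + 3)
   + c3 * (3 * y ^+ 2 + 3 * y + 1)) by ring.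
(* Coefficientwise comparison with [k (y + 1)^2]; the values 16, 11 and 7 used for [k] are
   generous. *)
have bnd (s : K) (u v w k : nat) : (u <= k)%N -> (v <= k.*2)%N -> (w <= k)%N ->
    `|s * (u%:R * y ^+ 2 + v%:R * y + w%:R)| <= k%:R * `|s| * (y + 1) ^+ 2.
  rewrite -!(ler_nat K) -muln2 natrM => uk vk wk.
  rewrite normrM mulrAC [leRHS]mulrC; apply: ler_wpM2l => //.
  rewrite ger0_norm ?addr_ge0 ?mulr_ge0 ?exprn_ge0 //.
  have := sqr_ge0 y; nra.
apply: le_trans (ler_normB _ _) _.
have h1 : C * y ^+ 2 <= `|C| * (y + 1) ^+ 2.
  apply: le_trans (ler_norm _) _; rewrite normrM; apply: ler_wpM2l => //.
  by rewrite ger0_norm ?exprn_ge0 // ler_sqr ?nnegrE; lra.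
have /(_ isT isT isT) b5 := bnd c5 10%N 15%N 6%N 16%N.
have /(_ isT isT isT) b4 := bnd c4 6%N 8%N 3%N 11%N.
have /(_ isT isT isT) := bnd c3 3%N 3%N 1%N 7%N.
rewrite mulr1n => b3.
apply: le_trans (lerD (le_trans hFa h1) (le_trans (ler_normD _ _)
  (lerD (le_trans (ler_normB _ _) (lerD b5 b4)) b3))) _.
by rewrite [leRHS]mulrDl [X in _ <= X + _]mulrDl [X in _ <= X + _ + _]mulrDl !addrA.
Qed.

(** Iterating [approx_pred] avoids a general binomial expansion. The [j ^+ 2] in the cubic
    coefficient is the source of the second moments. *)
Lemma approx_shift F c5 c4 c3 j : approx F c5 c4 c3 ->
  approx (fun a => F (a - j)%N) c5 (c4 - 5 * c5 * j%:R)
    (c3 - 4 * c4 * j%:R + 10 * c5 * j%:R ^+ 2).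
Proof.
move=> hF; elim: j => [|j IH].
  have -> : c4 - 5 * c5 * 0%:R = c4 by ring.
  have -> : c3 - 4 * c4 * 0%:R + 10 * c5 * 0%:R ^+ 2 = c3 by ring.
  by apply: (@approx_eq _ _ _ _ _ 0%N) hF => a _; rewrite subn0.
have -> : c4 - 5 * c5 * j.+1%:R = (c4 - 5 * c5 * j%:R) - 5 * c5.
  by rewrite -natr1; ring.
have -> : c3 - 4 * c4 * j.+1%:R + 10 * c5 * j.+1%:R ^+ 2 =
    (c3 - 4 * c4 * j%:R + 10 * c5 * j%:R ^+ 2) - 4 * (c4 - 5 * c5 * j%:R) + 10 * c5.
  by rewrite -natr1; ring.
have h := approx_pred IH; apply: (@approx_eq _ _ _ _ _ 0%N) h => a _.
have -> : (a - j.+1 = a.-1 - j)%N by lia.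
by [].
Qed.

(** About [s / k] steps, each adding an error of order [s^d], accumulate to order [s^(d+1)]; [B]
    covers the initial values below [k]. *)
Lemma rec_bound (E : nat -> K) k d D : (0 < k)%N ->
  (forall s, (k <= s)%N -> `|E s| <= `|E (s - k)%N| + D * s.+1%:R ^+ d) ->
  exists C, forall s, `|E s| <= C * s.+1%:R ^+ d.+1.
Proof.
move=> k0 hE; pose B : K := \sum_(i < k) `|E i|; exists (B + `|D|).
have B0 : 0 <= B by apply: sumr_ge0.
elim/ltn_ind=> s IH; have s1 : 1 <= s.+1%:R :> K by rewrite ler1n.
have [sk|ks] := ltnP s k.
  apply: (@le_trans _ _ (B + `|D|)); last by rewrite ler_peMr ?addr_ge0 // exprn_ege1.
  apply: (@le_trans _ _ B); last by rewrite lerDl.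
  by rewrite /B (bigD1 (Ordinal sk)) //= lerDl sumr_ge0.
apply: le_trans (hE s ks) _.
have lt_sk : (s - k < s)%N by lia.
have h1 := IH _ lt_sk; rewrite exprSr in h1 *.
set C : K := B + `|D| in h1 *.
have C0 : 0 <= C by rewrite addr_ge0.
have h2 : C * ((s - k).+1%:R ^+ d * (s - k).+1%:R) <= C * (s.+1%:R ^+ d * s%:R).
  apply: ler_wpM2l => //; apply: ler_pM; rewrite ?exprn_ge0 //.
    by rewrite lerXn2r ?nnegrE // ler_nat; lia.
  by rewrite ler_nat; lia.
have h3 : D * s.+1%:R ^+ d <= C * s.+1%:R ^+ d.
  apply: ler_wpM2r; first by rewrite exprn_ge0.
  by apply: le_trans (ler_norm _) _; rewrite lerDr.
apply: le_trans (lerD (le_trans h1 h2) h3) _.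
by rewrite -mulrDr -[X in _ + X]mulr1 -mulrDr natr1 -exprSr.
Qed.

End Approximation.

(** * Leading terms of the four denumerants *)

Section DenumerantAsymptotics.
Local Open Scope ring_scope.
Variable K : realFieldType.

Local Notation den ks := (fun s => (denumerant ks s)%:R : K).

Lemma natr_bin n m : ('C(n, m))%:R = (n ^_ m)%:R / (m`!)%:R :> K.
Proof.
by rewrite -bin_ffact natrM mulfK // pnatr_eq0 -lt0n fact_gt0.
Qed.

Lemma natr_ffact_rise s n :
  ((s + n) ^_ n)%:R = \prod_(i < n) (s%:R + i.+1%:R) :> K.
Proof.
rewrite ffact_prod natr_prod (reindex_inj rev_ord_inj) /=; apply: eq_bigr => i _.
by rewrite -natrD; congr _%:R; have := ltn_ord i; lia.
Qed.

Lemma natr_denumerant_ones n s : (denumerant (nseq n.+1 1%N) s)%:R =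
  (\prod_(i < n) (s%:R + i.+1%:R)) / (n`!)%:R :> K.
Proof. by rewrite denumerant_ones natr_bin natr_ffact_rise. Qed.

(** The numbers 15 and 85, and then 225, 274 and 120 in the remainder, are the elementary symmetric
    functions of 1, 2, 3, 4, 5. *)
Lemma approx_den_id :
  approx (den (nseq 6 1%N)) (1 / 120) (15 / 120) (85 / 120).
Proof.
exists 10, 1%N => a a1; rewrite natr_denumerant_ones !big_ord_recl big_ord0 /=.
rewrite -[5`!]/(120%N) /bump /=; set y : K := a%:R.
have y1 : 1 <= y by rewrite ler1n.
rewrite (_ : _ - _ = (225 * y ^+ 2 + 274 * y + 120) / 120); last by field.
by rewrite ger0_norm; nra.
Qed.

(** By [denumerant_rec] the denumerant of [k :: ks] has the denumerant of [ks] as its difference of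
    step [k]. A guess [p] is therefore right up to one order more than the error in
    [p s - p (s - k) = q s]. *)
Lemma denumerant_err k ks (p q : nat -> K) d D : (0 < k)%N ->
  (forall s, `|den ks s - q s| <= D * s.+1%:R ^+ d) ->
  (forall s, (k <= s)%N -> `|p s - p (s - k)%N - q s| <= D * s.+1%:R ^+ d) ->
  exists C, forall s, `|den (k :: ks) s - p s| <= C * s.+1%:R ^+ d.+1.
Proof.
move=> k0 hq hp; apply: (@rec_bound _ _ k d (D + D)) => // s ks0.
rewrite denumerant_rec // natrD.
have -> : (denumerant ks s)%:R + (denumerant (k :: ks) (s - k))%:R - p s =
  ((denumerant (k :: ks) (s - k))%:R - p (s - k)%N) +
  (((denumerant ks s)%:R - q s) - (p s - p (s - k)%N - q s)) :> K by ring.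
apply: le_trans (ler_normD _ _) _; rewrite lerD2l mulrDl.
by apply: le_trans (ler_normB _ _) _; apply: lerD; [apply: hq|apply: hp].
Qed.

Lemma denumerant_err_approx ks c4 c3 C :
  (forall s, `|den ks s - (c4 * s%:R ^+ 4 + c3 * s%:R ^+ 3)| <= C * s.+1%:R ^+ 2) ->
  approx (den ks) 0 c4 c3.
Proof.
move=> /approx_small[D [N h]]; exists D, N => a /h.
by rewrite !mul0r !addr0 add0r subr0.
Qed.

Lemma approx_den_transp :
  approx (den (2 :: nseq 4 1)%N) 0 (1 / 48) (1 / 4).
Proof.
(* For [x s^4 + y s^3] the difference of step 2 starts with [8 x s^3 + (6 y - 24 x) s^2]; matching
   it with [s^3 / 6 + s^2] gives 1/48 and 1/4. *)
have [||| C hC] := @denumerant_err 2 (nseq 4 1%N)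
    (fun s => 1 / 48 * s%:R ^+ 4 + 1 / 4 * s%:R ^+ 3)
    (fun s => (s%:R + 1) * (s%:R + 2) * (s%:R + 3) / 6) 1 5 => //.
- move=> s; rewrite natr_denumerant_ones !big_ord_recl big_ord0 /= /bump /=.
  rewrite -[3`!]/(6%N) (_ : _ - _ = 0); last by field.
  by rewrite normr0 mulr_ge0.
- move=> s s2; rewrite natrB // -natr1 expr1; set y : K := s%:R.
  have y0 : 0 <= y by rewrite ler0n.
  rewrite (_ : _ - _ = 2 / 3 - 25 / 6 * y); last by field.
  by rewrite ler_norml; apply/andP; split; lra.
exact: denumerant_err_approx hC.
Qed.

Lemma approx_den_cycle :
  approx (den (3 :: nseq 3 1)%N) 0 0 (1 / 18).
Proof.
(* The difference of step 3 of [y s^3] starts with [9 y s^2], to be [s^2 / 2]. *)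
have [||| C hC] := @denumerant_err 3 (nseq 3 1%N)
    (fun s => 0 * s%:R ^+ 4 + 1 / 18 * s%:R ^+ 3)
    (fun s => (s%:R + 1) * (s%:R + 2) / 2) 1 5 => //.
- move=> s; rewrite natr_denumerant_ones !big_ord_recl big_ord0 /= /bump /=.
  rewrite -[2`!]/(2%N) (_ : _ - _ = 0); last by field.
  by rewrite normr0 mulr_ge0.
- move=> s s2; rewrite natrB // -natr1 expr1; set y : K := s%:R.
  have y0 : 0 <= y by rewrite ler0n.
  rewrite (_ : _ - _ = 1 / 2 - 3 * y); last by field.
  by rewrite ler_norml; apply/andP; split; lra.
exact: denumerant_err_approx hC.
Qed.

Lemma approx_den_double :
  approx (den (2 :: 2 :: nseq 2 1)%N) 0 0 (1 / 24).
Proof.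
(* The two cycles of length 2 are adjoined one at a time: [s^2 / 4] has a difference with leading
   term [s], and [s^3 / 24] one with leading term [s^2 / 4]. *)
have [||| D hD] := @denumerant_err 2 (nseq 2 1%N)
    (fun s => 1 / 4 * s%:R ^+ 2) (fun s => s%:R + 1) 0 2 => //.
- move=> s; rewrite natr_denumerant_ones !big_ord_recl big_ord0 /= /bump /=.
  rewrite -[1`!]/(1%N) (_ : _ - _ = 0); last by field.
  by rewrite normr0 mulr_ge0.
- move=> s s2; rewrite natrB // expr0; set y : K := s%:R.
  rewrite (_ : _ - _ = - 2); last by field.
  by rewrite ler_norml; apply/andP; split; lra.
have D0 : 0 <= D by have := hD 0%N; rewrite expr1n mulr1; apply: le_trans.
have [||| C hC] := @denumerant_err 2 (2 :: nseq 2 1)%N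
    (fun s => 0 * s%:R ^+ 4 + 1 / 24 * s%:R ^+ 3)
    (fun s => 1 / 4 * s%:R ^+ 2) 1 (D + 2) => //.
- move=> s; apply: le_trans (hD s) _; apply: ler_wpM2r; first by rewrite exprn_ge0.
  by rewrite lerDl.
- move=> s s2; rewrite natrB // -natr1 expr1; set y : K := s%:R.
  have y0 : 0 <= y by rewrite ler0n.
  rewrite (_ : _ - _ = 1 / 3 - 1 / 2 * y); last by field.
  have Dy : 0 <= D * (y + 1) by rewrite mulr_ge0 ?addr_ge0.
  by rewrite ler_norml; apply/andP; split; lra.
exact: denumerant_err_approx hC.
Qed.

End DenumerantAsymptotics.

(** * Computed moments of the weight *)

Section Moments.
Import BinNat.
(* In this section %N denotes binary naturals. *)
Local Notation moment hl k j := (weight_moment 6 (block_orbits 6 (nth O hl) k) j).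

Lemma moments_id : [/\ moment id6 1 0 = 185521%N,
  moment id6 1 1 = 1277263%N & moment id6 1 2 = 9317345%N].
Proof. by split; vm_compute. Qed.

Lemma moments_transp : [/\ moment transp6 2 0 = 7233%N,
  moment transp6 2 1 = 50567%N & moment transp6 2 2 = 386001%N].
Proof. by split; vm_compute. Qed.

(** [perm_bits] expects the inverse permutation, hence the inverse of [cycle6] here; the other
    representatives are their own inverses. *)
Lemma moments_cycle : [/\ moment [:: 2; 0; 1; 3; 4; 5] 3 0 = 349%N,
  moment [:: 2; 0; 1; 3; 4; 5] 3 1 = 2371%N & moment [:: 2; 0; 1; 3; 4; 5] 3 2 = 18689%N].
Proof. by split; vm_compute. Qed.

Lemma moments_double : [/\ moment double6 2 0 = 1713%N,
  moment double6 2 1 = 11951%N & moment double6 2 2 = 91609%N].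
Proof. by split; vm_compute. Qed.

End Moments.

(** * Summing the contributions of the four classes *)

Section Assembly.
Import mathcomp.boot.fintype mathcomp.boot.finset.
Local Open Scope ring_scope.
Variable K : realFieldType.

(** Turns a computed binary number into a short ring expression that [field] can handle, bypassing
    unary numerals. *)
Fixpoint pos_ring (p : BinNums.positive) : K :=
  match p with
  | BinNums.xH => 1 | BinNums.xO q => 2 * pos_ring q | BinNums.xI q => 1 + 2 * pos_ring q
  end.

Lemma natr_pos p : (BinNat.N.to_nat (BinNums.Npos p))%:R = pos_ring p.
Proof.
elim: p => [p IH|p IH|] //=; rewrite -IH /=.
  by rewrite Pnat.Pos2Nat.inj_xI multE -natr1 natrM addrC.
by rewrite Pnat.Pos2Nat.inj_xO multE natrM.
Qed.

(** [hl] lists the inverse of [gl]; one evaluation certifies all data attached to a class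
    representative. *)
Definition wf_perm6 (gl hl reps pl ks : seq nat) (k : nat) : bool :=
  [&& perm_eq gl (iota 0 6),
    all (fun i => (nth 0 gl (nth 0 hl i) == i) && (nth 0 hl i < 6))%N (iota 0 6),
    wf_orbits 6 (nth 0%N hl) k (block_orbits 6 (nth 0%N hl) k) &
    wf_cycles 6 gl reps pl ks].

(** For each invariant [H] the denumerant is shifted by [weight H]; summing the shifted coefficients
    over [H] turns the powers of the weight into moments. *)
Lemma approx_fix_configs (gl hl reps pl ks : seq nat) (k : nat) (c5 c4 c3 : K)
    (n0 n1 n2 : BinNums.positive) (gs := block_orbits 6 (nth 0%N hl) k) :
  wf_perm6 gl hl reps pl ks k ->
  [/\ weight_moment 6 gs 0 = BinNums.Npos n0, weight_moment 6 gs 1 = BinNums.Npos n1 &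
      weight_moment 6 gs 2 = BinNums.Npos n2] ->
  approx (fun s => (denumerant ks s)%:R) c5 c4 c3 ->
  approx (fun a => (fix_configs a (seq_perm 6 gl))%:R)
    (c5 * pos_ring n0) (c4 * pos_ring n0 - 5 * c5 * pos_ring n1)
    (c3 * pos_ring n0 - 4 * c4 * pos_ring n1 + 10 * c5 * pos_ring n2).
Proof.
case/and4P => gl6 inv wfo wfc [e0 e1 e2] apx; rewrite -!natr_pos -e0 -e1 -e2.
pose mom j : K := (BinNat.N.to_nat (weight_moment 6 gs j))%:R.
rewrite -!/(mom _); set g := seq_perm 6 gl.
have gE (i : 'I_6) : g i = nth 0%N gl i :> nat by rewrite -(seq_permK gl6) nth_perm_seq.
have giE (i : 'I_6) : nth 0%N hl i = (g^-1)%g i.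
  have /allP/(_ (val i)) := inv; rewrite mem_iota ltn_ord => /(_ isT)/andP[/eqP e lt6].
  rewrite -[nth _ _ _]/(val (Ordinal lt6)); congr val.
  by apply: (@perm_inj _ g); rewrite permKV; apply: val_inj; rewrite /= gE.
have momE j : mom j = \sum_(H | invariant_space g H) (weight H)%:R ^+ j.
  rewrite /mom -(weight_momentE giE wfo) natr_sum.
  by apply: eq_bigr => H _; rewrite natrX.
pose F H a : K := (denumerant ks (a - weight H))%:R.
have apF := approx_sum (index_enum _) (invariant_space g)
  (fun H : {set {set 'I_6}} => approx_shift (weight H) apx).
have -> : c5 * mom 0%N = \sum_(H | invariant_space g H) c5.
  by rewrite momE mulr_sumr; apply: eq_bigr => H _; rewrite mulr1.
have -> : c4 * mom 0%N - 5 * c5 * mom 1%N =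
    \sum_(H | invariant_space g H) (c4 - 5 * c5 * (weight H)%:R).
  by rewrite !momE !mulr_sumr -sumrB; apply: eq_bigr => H _; rewrite mulr1.
have -> : c3 * mom 0%N - 4 * c4 * mom 1%N + 10 * c5 * mom 2%N =
    \sum_(H | invariant_space g H)
      (c3 - 4 * c4 * (weight H)%:R + 10 * c5 * (weight H)%:R ^+ 2).
  by rewrite !momE !mulr_sumr -sumrB -big_split; apply: eq_bigr => H _; rewrite mulr1.
(* From the largest weight on, every [H] occurs and no subtraction is truncated. *)
apply: (@approx_eq _ _ _ _ _ _ (\max_(H : {set {set 'I_6}}) weight H)%N) apF => a Wa.
have wa (H : {set {set 'I_6}}) : (weight H <= a)%N.
  by apply: leq_trans _ Wa; apply: leq_bigmax.
rewrite fix_configsE natr_sum; apply: eq_big => [H|H _]; first by rewrite wa andbT.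
by rewrite (invariant_sums_denumerant gE wfc) ?leq_subr.
Qed.

Lemma approx_fix_id :
  approx (fun a => (fix_configs a (seq_perm 6 id6))%:R : K) (185521%N%:R / 120)
   ((15 * 185521%N%:R - 5 * 1277263%N%:R) / 120)
   ((85 * 185521%N%:R - 60 * 1277263%N%:R + 10 * 9317345%N%:R) / 120).
Proof.
have wf : wf_perm6 id6 id6 id6 id6 (nseq 6 1%N) 1 by vm_compute.
have := approx_fix_configs wf moments_id (approx_den_id K).
rewrite [pos_ring _]/= [pos_ring _]/= [pos_ring _]/=.
by congr approx; field.
Qed.

Lemma approx_fix_transp :
  approx (fun a => (fix_configs a (seq_perm 6 transp6))%:R : K) 0 (7233%N%:R / 48)
   (7233%N%:R / 4 - 50567%N%:R / 12).
Proof.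
have wf : wf_perm6 transp6 transp6 [:: 0; 2; 3; 4; 5]%N [:: 0; 0; 1; 2; 3; 4]%N
  (2 :: nseq 4 1)%N 2 by vm_compute.
have := approx_fix_configs wf moments_transp (approx_den_transp K).
rewrite [pos_ring _]/= [pos_ring _]/= [pos_ring _]/=.
by congr approx; field.
Qed.

Lemma approx_fix_cycle :
  approx (fun a => (fix_configs a (seq_perm 6 cycle6))%:R : K) 0 0 (349 / 18).
Proof.
have wf : wf_perm6 cycle6 [:: 2; 0; 1; 3; 4; 5]%N [:: 0; 3; 4; 5]%N
  [:: 0; 0; 0; 1; 2; 3]%N (3 :: nseq 3 1)%N 3 by vm_compute.
have := approx_fix_configs wf moments_cycle (approx_den_cycle K).
rewrite [pos_ring _]/= [pos_ring _]/= [pos_ring _]/=.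
by congr approx; field.
Qed.

Lemma approx_fix_double :
  approx (fun a => (fix_configs a (seq_perm 6 double6))%:R : K) 0 0 (1713 / 24).
Proof.
have wf : wf_perm6 double6 double6 [:: 0; 2; 4; 5]%N
  [:: 0; 0; 1; 1; 2; 3]%N (2 :: 2 :: nseq 2 1)%N 2 by vm_compute.
have := approx_fix_configs wf moments_double (approx_den_double K).
rewrite [pos_ring _]/= [pos_ring _]/= [pos_ring _]/=.
by congr approx; field.
Qed.

Lemma burnside6 : exists B : nat, forall a, exists2 E, (E <= B * a.+1 ^ 2)%N &
  (#|config_orbits 'I_6 a| * 720 =
   fix_configs a (seq_perm 6 id6) + 15 * fix_configs a (seq_perm 6 transp6)
   + 40 * fix_configs a (seq_perm 6 cycle6) + 45 * fix_configs a (seq_perm 6 double6)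
   + E)%N.
Proof.
exists (720 * #|{set {set 'I_6}}|)%N => a.
have -> : 720%N = #|{perm 'I_6}| by rewrite card_Sn.
rewrite burnside_configs -mulnA card_Sn; apply: sum_class6.
- exact: fix_configs_conj.
- exact: fix_configs_le.
Qed.

Lemma approx_orbits :
  approx (fun a => #|config_orbits 'I_6 a|%:R : K)
    (185521%N%:R / 86400%N%:R) (- (266581%N%:R / 6912%N%:R))
    (4268287%N%:R / 12960%N%:R).
Proof.
have [B hB] := burnside6.
pose f gl a : K := (fix_configs a (seq_perm 6 gl))%:R.
pose M a : K := f id6 a + 15 * f transp6 a + 40 * f cycle6 a + 45 * f double6 a.
pose N a : K := #|config_orbits 'I_6 a|%:R.
(* The difference is the Burnside contribution of the permutations with at most three cycles. *)
have small : approx (fun a => N a * 720 - M a) 0 0 0.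
  apply: (@approx_small _ _ B%:R) => a; have [E leE sumE] := hB a.
  have -> : N a * 720 - M a = E%:R.
    have natrE (n k m1 k2 m2 k3 m3 k4 m4 e : nat) :
        (n * k = m1 + k2 * m2 + k3 * m3 + k4 * m4 + e)%N ->
        n%:R * k%:R - (m1%:R + k2%:R * m2%:R + k3%:R * m3%:R + k4%:R * m4%:R) = e%:R :> K.
      by rewrite -!natrM -!natrD => ->; rewrite natrD addrC addKr.
    exact: natrE sumE.
  by rewrite ger0_norm // -natrX -natrM ler_nat.
have h := approx_scale (1 / 720)
  (approx_add (approx_add (approx_add (approx_add approx_fix_id
    (approx_scale 15 approx_fix_transp)) (approx_scale 40 approx_fix_cycle))
    (approx_scale 45 approx_fix_double)) small).
have NE a : (0 <= a)%N -> 1 / 720 * (M a + (N a * 720 - M a)) = N a.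
  have cancel (x y : K) : 1 / 720 * (x + (y * 720 - x)) = y by field.
  by move=> _; apply: cancel.
by apply: (approx_coef (approx_eq NE h)); field.
Qed.

End Assembly.

Lemma approx_bigO (K : realType) (F : nat -> K) (c5 c4 c3 : K) :
  approx F c5 (- c4) c3 ->
  F = (fun a => c5 * a%:R ^+ 5 - c4 * a%:R ^+ 4 + c3 * a%:R ^+ 3 : K)
    +O_\oo (fun a => a%:R ^+ 2 : K).
Proof.
move=> [C [N h]]; apply/eqaddOP; exists C; split; first exact: num_real.
move=> k Ck; exists N => // a Na; rewrite /= (ger0_norm (exprn_ge0 2 (ler0n K a))).
apply: le_trans _ (ler_wpM2r (exprn_ge0 2 (ler0n K a)) (ltW Ck)).
by have := h a Na; rewrite mulNr.
Qed.

Theorem theorem7p7 (K : realType) :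
  (fun a : nat => (R 6 a)%:R : K) =
  (fun a : nat => 185521%N%:R / 86400%N%:R * a%:R ^+ 5
                  - 266581%N%:R / 6912%N%:R * a%:R ^+ 4
                  + 4268287%N%:R / 12960%N%:R * a%:R ^+ 3 : K)
  +O_\oo (fun a : nat => a%:R ^+ 2 : K).
Proof.
have RE a : (0 <= a)%N -> #|config_orbits 'I_6 a|%:R = (R 6 a)%:R :> K.
  move=> _; congr (_%:R).
  (* [R] is a chosen value, so it is identified with the orbit count through the uniqueness of the
     number of classes. *)
  by apply: num_iso_classes_unique (num_iso_classes_orbits a _) (num_iso_classes_R 6 a).
exact: approx_bigO (approx_eq RE (approx_orbits K)).
Qed.
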